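(* There exists a constant $c>0$, independent of $N$, such that for infinitely many $N\in\mathbb{N}$ there are two ground states $\mathcal{S}_N'$ and $\tilde{\mathcal{S}}_N$ with $N$ atoms such that $$\inf\bigl\{\|\mu_N'-\tilde\mu_N(R\,\cdot+a)\| : R\in O(2),\ a\in\mathbb{R}^2\bigr\}\ \ge\ c\,N^{-1/4},$$ where $\mu_N'=\frac1N\sum_{x\in\mathcal{S}_N'}\delta_{x/\sqrt N}$ and $\tilde\mu_N=\frac1N\sum_{x\in\tilde{\mathcal{S}}_N}\delta_{x/\sqrt N}$.
   Context: The energy of $N$ particles at positions $x_1,\dots,x_N\in\mathbb{R}^2$ is $E(x_1,\dots,x_N)=\sum_{i\ne j}V_{\rm HR}(|x_i-x_j|)$, where $V_{\rm HR}(r)=+\infty$ for $0\le r<1$, $V_{\rm HR}(1)=-1$, and $V_{\rm HR}(r)=0$ for $r>1$. A ground state with $N$ atoms is a set $\{x_1,\dots,x_N\}\subset\mathbb{R}^2$ of $N$ points minimizing $E$ among all $N$-particle configurations. $\delta_y$ is the Dirac measure at $y$. For a measure $\nu$ on $\mathbb{R}^2$, $\nu(R\,\cdot+a)$ denotes the measure $A\mapsto\nu(RA+a)$. For a finite signed Borel measure $\nu$ on $\mathbb{R}^2$, $\|\nu\|$ denotes the flat norm $$\|\nu\|=\sup\Bigl\{\int\varphi\,d\nu:\ \varphi:\mathbb{R}^2\to\mathbb{R}\text{ Lipschitz with } |\varphi|\le1\text{ and Lipschitz constant}\le1\Bigr\}.$$ *)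

(* Defs.v *)
From HB Require Import structures.
From mathcomp Require Import all_boot all_order all_algebra finmap.
From mathcomp Require Import all_classical all_reals all_analysis.

Set Implicit Arguments.
Unset Strict Implicit.
Unset Printing Implicit Defensive.

Import Order.TTheory GRing.Theory Num.Theory.
Import numFieldNormedType.Exports.

Local Open Scope classical_set_scope.
Local Open Scope ring_scope.

(* The plane is ['cV[R]_2].  The library norm on matrices is the sup norm; it
   induces the usual topology, but distances must be measured with [enorm]. *)
Definition enorm (R : realType) (x : 'cV[R]_2) : R :=
  Num.sqrt (\sum_(i < 2) x i 0 ^+ 2).

(* [V_HR]; only its values at r >= 0 matter. *)
Definition V_HR (R : realType) (r : R) : \bar R :=
  if r < 1 then +oo%E else if r == 1 then (-1)%E else 0%E.

Definition energy (R : realType) (N : nat) (x : 'I_N -> 'cV[R]_2) : \bar R :=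
  (\sum_(i < N) \sum_(j < N | i != j) V_HR (enorm (x i - x j)))%E.

Definition ground_state (R : realType) (N : nat) (S : {fset 'cV[R]_2}) : Prop :=
  #|` S|%fset = N /\
  exists x : 'I_N -> 'cV[R]_2,
    S = [fset x i | i : 'I_N]%fset /\
    forall y : 'I_N -> 'cV[R]_2, (energy x <= energy y)%E.

Notation borel_plane R := (g_sigma_algebraType (@open 'cV[R]_2)).

Lemma continuous_borel (R : realType) (f : 'cV[R]_2 -> 'cV[R]_2) :
  continuous f -> measurable_fun setT (f : borel_plane R -> borel_plane R).
Proof.
move=> /continuousP cf.
have sub : preimage_set_system setT f (@open 'cV[R]_2) `<=`
    (measurable : set (set (borel_plane R))).
  move=> _ [B oB <-].
  by rewrite setTI; apply: sub_sigma_algebra; exact: cf.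
exact: (@measurability _ _ (borel_plane R) (borel_plane R) setT f
  (@open 'cV[R]_2) _ sub).
Qed.

Section empirical_measure.
Context (R : realType) (N : nat) (S : {fset 'cV[R]_2}).

Definition empirical_measure (A : set (borel_plane R)) : \bar R :=
  (N%:R^-1%:E *
   \sum_(x <- S) \d_(((Num.sqrt N%:R)^-1 *: x : borel_plane R)) A)%E.

Let r : {nonneg R} := (N%:R^-1)%:nng.
Let m := fun k : nat =>
  dirac ((Num.sqrt N%:R)^-1 *: nth 0 S k : borel_plane R) : {measure set _ -> \bar R}.

Let empiricalE : empirical_measure = mscale r (msum m (size S)).
Proof.
apply/funext => A; rewrite /empirical_measure /mscale /msum /=.
by rewrite (big_nth 0) big_mkord.
Qed.

Let empirical0 : empirical_measure set0 = 0%E.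
Proof. by rewrite empiricalE measure0. Qed.

Let empirical_ge0 A : (0 <= empirical_measure A)%E.
Proof. by rewrite empiricalE measure_ge0. Qed.

Let empirical_sigma_additive : semi_sigma_additive empirical_measure.
Proof. by rewrite empiricalE; exact: measure_semi_sigma_additive. Qed.

HB.instance Definition _ := isMeasure.Build _ _ _ empirical_measure
  empirical0 empirical_ge0 empirical_sigma_additive.

Let empirical_fin : fin_num_fun empirical_measure.
Proof.
move=> A mA; rewrite /empirical_measure fin_numM//.
by rewrite sum_fin_num; apply/allP => _ /mapP[x _ ->]; rewrite diracE.
Qed.

HB.instance Definition _ := @Measure_isFinite.Build _ _ _
  empirical_measure empirical_fin.

End empirical_measure.

Record orthogonal2 (R : realType) := Orthogonal2 {
  orthogonal2_mx :> 'M[R]_2 ;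
  orthogonal2P : orthogonal2_mx *m orthogonal2_mx^T = 1%:M }.

Definition isometry_of (R : realType) (Q : orthogonal2 R) (a : 'cV[R]_2)
  (x : 'cV[R]_2) : 'cV[R]_2 := Q *m x + a.

Lemma affine_continuous (R : realType) (Q : 'M[R]_2) (a : 'cV[R]_2) :
  continuous (fun x : 'cV[R]_2 => Q *m (x - a)).
Proof.
move=> x; have Fx : Filter (nbhs x) := nbhs_filter x.
apply/(@cvgrPdist_lt _ _ _ _ Fx) => e e0.
pose K := 1 + \sum_(i < 2) \sum_(j < 2) `|Q i j|.
have S0 : 0 <= \sum_(i < 2) \sum_(j < 2) `|Q i j|.
  by apply: sumr_ge0 => i _; apply: sumr_ge0.
have K0 : 0 < K by rewrite /K ltr_pwDl.
apply/nbhs_ballP; exists (e / K) => [|y]; first by rewrite /= divr_gt0.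
rewrite -ball_normE /= => xy.
rewrite -mulmxBr opprB addrA subrK.
have xyK (j : 'I_2) : `|(x - y) j 0| <= `|x - y|.
  rewrite [leRHS]mx_normrE.
  exact: (le_bigmax _ (fun ij : 'I_2 * 'I_1 => `|(x - y) ij.1 ij.2|) (j, 0)).
apply: (@le_lt_trans _ _ (`|x - y| * K)); last by rewrite -ltr_pdivlMr.
rewrite [leLHS]mx_normrE; apply/bigmax_leP; split => [|[i j] _ /=].
  by rewrite mulr_ge0// ltW.
rewrite ord1 mxE (le_trans (ler_norm_sum _ _ _))//.
apply: (@le_trans _ _ (`|x - y| * \sum_(j < 2) `|Q i j|)).
  rewrite mulr_sumr ler_sum// => k _.
  by rewrite normrM mulrC ler_wpM2r.
rewrite ler_wpM2l// /K [in leRHS](bigD1 i)//= addrCA -[leLHS]addr0 lerD2l.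
by rewrite addr_ge0// sumr_ge0// => k _; exact: sumr_ge0.
Qed.

(* nu(Q . + a) : A |-> nu (Q A + a) *)
Section moved_measure.
Context (R : realType) (nu : {finite_measure set (borel_plane R) -> \bar R}).
Context (Q : orthogonal2 R) (a : 'cV[R]_2).

Definition moved_measure (A : set (borel_plane R)) : \bar R :=
  nu (isometry_of Q a @` A).

Let inv_isometry (y : borel_plane R) : borel_plane R :=
  (Q : 'M[R]_2)^T *m (y - a : 'cV[R]_2).

Let measurable_inv_isometry : measurable_fun setT inv_isometry.
Proof. exact: (continuous_borel (@affine_continuous R Q^T a)). Qed.

Let moved_measureE : moved_measure = pushforward nu inv_isometry.
Proof.
apply/funext => A; rewrite /moved_measure /pushforward; congr (nu _).
apply/seteqP; split => [_ [x Ax <-]|y /= Ay].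
  rewrite /= /inv_isometry /isometry_of addrK mulmxA.
  by rewrite (mulmx1C (orthogonal2P Q)) mul1mx.
exists (inv_isometry y) => //.
by rewrite /isometry_of /inv_isometry mulmxA orthogonal2P mul1mx subrK.
Qed.

Let moved0 : moved_measure set0 = 0%E.
Proof. by rewrite /moved_measure image_set0 measure0. Qed.

Let moved_ge0 A : (0 <= moved_measure A)%E.
Proof. exact: measure_ge0. Qed.

Let moved_sigma_additive : semi_sigma_additive moved_measure.
Proof.
rewrite moved_measureE; apply: measure_semi_sigma_additive.
exact: measurable_inv_isometry.
Qed.

HB.instance Definition _ := isMeasure.Build _ _ _ moved_measure
  moved0 moved_ge0 moved_sigma_additive.

Let moved_fin : fin_num_fun moved_measure.
Proof.
move=> A mA; rewrite moved_measureE /pushforward fin_num_measure//.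
by rewrite -[X in measurable X]setTI; exact: measurable_inv_isometry.
Qed.

HB.instance Definition _ := @Measure_isFinite.Build _ _ _
  moved_measure moved_fin.

End moved_measure.

(* Integral against a signed measure, through its Jordan decomposition (which
   does not depend on the chosen Hahn decomposition). *)
Section charge_integral.
Context d (T : measurableType d) (R : realType).
Variable nu : {charge set T -> \bar R}.

Let P : set T := sval (cid (Hahn_decomposition nu)).
Let PN : exists N, hahn_decomposition nu P N :=
  svalP (cid (Hahn_decomposition nu)).
Let N : set T := sval (cid PN).
Let nuPN : hahn_decomposition nu P N := svalP (cid PN).

Definition charge_integral (f : T -> R) : \bar R :=
  (\int[jordan_pos nuPN]_x (f x)%:E - \int[jordan_neg nuPN]_x (f x)%:E)%E.

End charge_integral.

Definition flat_norm (R : realType)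
    (nu : {charge set (borel_plane R) -> \bar R}) : \bar R :=
  ereal_sup [set charge_integral nu phi | phi in
    [set phi : 'cV[R]_2 -> R |
      (forall x, `|phi x| <= 1) /\
      (forall x y, `|phi x - phi y| <= enorm (x - y))]].

(* Main.v *)
(** Ground states are identified through Harborth's bound: if [D] counts the
ordered contact pairs of [N] points, then [(6 N - D)^2 >= 48 N - 12].  It is
proved by peeling off the boundary layer.  Go around every vertex and call the
angle between two cyclically consecutive contacts a gap; a gap is at least
pi/3.  Let [l] be the number of gaps facing the unbounded region and [b] the
number of vertices carrying them.  These gaps add up to at least (l + 2) pi.
Comparing with the total angle at all vertices gives D + 2 l + 6 <= 6 N, and
comparing with the total angle at the [b] boundary vertices bounds the contacts
lost when they are removed; the two estimates together are exactly what the
induction needs.  That the exterior gaps add up to at least (l + 2) pi is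
proved without the Jordan curve theorem, by a vertical sweep: cells of the
sweep are named by the edge below them, each vertex glues the cell to the left
of the space just above it to the cell to its right, and the resulting
component of the unbounded cell is a connected graph containing a cycle.

Take k = 12 m^2 and N = 3 k^2 + 2 k + 1.  Both the regular hexagon of side k
with k points of one side removed and the stretched hexagon |a| <= k + 2 m,
|b|, |c| <= k - m (a + b + c = 0) have N points and minimal energy.  The second
moment of the former is at most that of the full hexagon, which is isotropic,
while the latter exceeds it along one direction by 3/4 m k^3.  A clipped
quadratic function along that direction detects this after any isometry, and
translations only help because the stretched hexagon is centrally symmetric. *)

Require Import Defs.
From HB Require Import structures.
From mathcomp Require Import all_boot all_order all_algebra finmap.
From mathcomp Require Import all_classical all_reals all_analysis.
From mathcomp Require Import measurable_realfun ring lra zify.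

Set Implicit Arguments.
Unset Strict Implicit.
Unset Printing Implicit Defensive.

Import Order.TTheory GRing.Theory Num.Theory.
Import numFieldNormedType.Exports.

Local Open Scope ring_scope.

(** * Angles around the vertices of a contact graph *)

Section CyclicSuccessor.
Variables (R : realDomainType) (T : finType) (A : {set T}) (k : T -> R).
Hypothesis kinj : {in A &, injective k}.

(** Cyclic order by increasing [k]: the second branch closes the cycle from the largest key back to
    the smallest. For [a] in [A] its default is never taken. *)
Definition csucc a :=
  if [pick b in A | (k a < k b) && [forall c in A, (k a < k c) ==> (k b <= k c)]]
    is Some b then b
  else odflt a [pick b in A | [forall c in A, k b <= k c]].

(** Non-strict, so that a one-element set, whose element succeeds itself, still makes one full
    turn. *)
Definition wraps a := k (csucc a) <= k a.

Variant csucc_spec a : T -> bool -> Type :=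
| CsuccNext b of b \in A & k a < k b &
    (forall c, c \in A -> k a < k c -> k b <= k c) : csucc_spec a b false
| CsuccWrap b of b \in A & (forall c, c \in A -> k c <= k a) &
    (forall c, c \in A -> k b <= k c) : csucc_spec a b true.

Lemma csuccP a : a \in A -> csucc_spec a (csucc a) (wraps a).
Proof.
move=> aA; rewrite /wraps /csucc; case: pickP => [b|no].
  move=> /and3P[bA ab /forall_inP bmin]; rewrite leNgt ab; constructor=> //.
  by move=> c cA; apply/implyP/bmin.
have amax c : c \in A -> k c <= k a.
  move=> cA; rewrite leNgt; apply/negP => ac.
  have P0 : (c \in A) && (k a < k c) by rewrite cA.
  case: (@arg_minP _ _ _ c (fun b => (b \in A) && (k a < k b)) k P0).
  move=> b /andP[bA ab] bmin; have /negP[] := negbT (no b).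
  rewrite bA ab /=; apply/forall_inP => d dA; apply/implyP => ad.
  by apply: bmin; rewrite dA.
case: pickP => [b /andP[bA /forall_inP bmin]|no'] /=.
  by rewrite bmin//; constructor.
case: (@arg_minP _ _ _ a (fun b => b \in A) k aA) => b bA bmin.
have /negP[] := negbT (no' b); rewrite bA; apply/forall_inP => c.
exact: bmin.
Qed.

Lemma csucc_in a : a \in A -> csucc a \in A.
Proof. by move=> aA; case: (csuccP aA). Qed.

Lemma csucc_inj : {in A &, injective csucc}.
Proof.
move=> a b aA bA; case: (csuccP aA) => c cA ac cmin; case: (csuccP bA) => d dA bd dmin.
- move=> cd; apply: kinj => //; apply/eqP; rewrite eq_le !leNgt; apply/andP; split.
    by apply/negP => /(dmin _ aA); rewrite -cd leNgt ac.
  by apply/negP => /(cmin _ bA); rewrite cd leNgt bd.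
- by move=> cd; have := dmin _ aA; rewrite -cd leNgt ac.
- by move=> cd; have := cmin _ bA; rewrite cd leNgt bd.
- by move=> _; apply: kinj => //; apply/eqP; rewrite eq_le bd//= ac.
Qed.

Lemma csucc_neq a : (1 < #|A|)%N -> a \in A -> csucc a != a.
Proof.
move=> A1 aA; case: (csuccP aA) => b bA.
  by move=> lt _; apply: contraTneq lt => ->; rewrite ltxx.
move=> amax bmin; apply: contraTneq A1 => ba; rewrite -leqNgt.
apply/card_le1_eqP => c d cA dA.
have eqa e : e \in A -> e = a.
  by move=> eA; apply: kinj => //; apply/eqP; rewrite eq_le amax//= -ba bmin.
by rewrite (eqa c)// (eqa d).
Qed.

Lemma reindex_csucc (F : T -> R) : \sum_(a in A) F (csucc a) = \sum_(a in A) F a.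
Proof.
rewrite -(big_imset F csucc_inj); apply: eq_bigl => a.
suff /setP -> : csucc @: A = A by [].
apply/eqP; rewrite eqEcard card_in_imset ?leqnn ?andbT; last exact: csucc_inj.
by apply/fintype.subsetP => _ /imsetP[b bA ->]; exact: csucc_in.
Qed.

Lemma wraps_max a : a \in A -> wraps a = [forall c in A, k c <= k a].
Proof.
move=> aA; case: (csuccP aA) => b bA; last first.
  by move=> amax _; apply/esym/forall_inP.
by move=> ab _; apply/esym/forall_inP => /(_ b bA); rewrite leNgt ab.
Qed.

Lemma sum_wraps a0 : a0 \in A -> \sum_(a in A) (wraps a)%:R = 1 :> R.
Proof.
move=> a0A; case: (@arg_maxP _ _ _ a0 (fun b => b \in A) k a0A) => m mA mmax.
rewrite (bigD1 m)//= big1 ?addr0 => [|a /andP[aA am]].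
  by rewrite wraps_max//; have -> : [forall c in A, k c <= k m] by apply/forall_inP.
rewrite wraps_max//; case: forall_inP => //= amax; case/eqP: am.
by apply: kinj => //; apply/eqP; rewrite eq_le; apply/andP; split; [exact: mmax|exact: amax].
Qed.

(** The differences telescope because [csucc] permutes [A], and exactly one element wraps,
    contributing the full turn [c]. *)
Lemma sum_gaps c a0 : a0 \in A ->
  \sum_(a in A) (k (csucc a) - k a + c * (wraps a)%:R) = c.
Proof.
move=> a0A; rewrite big_split/= sumrB reindex_csucc subrr add0r -mulr_sumr.
by rewrite (sum_wraps a0A) mulr1.
Qed.

End CyclicSuccessor.

(** * Angle count along the exterior darts *)

Section Counting.
Variables (R : realDomainType) (V : finType) (adj : rel V).
Variables (angle : V -> V -> R) (left : V -> V -> bool).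
Hypothesis adj_sym : symmetric adj.
Hypothesis left_anti : forall u v, adj u v -> left v u = ~~ left u v.
Hypothesis angle_rev : forall u v, adj u v -> left u v -> angle v u = angle u v + 3.
Hypothesis angle_sep : forall u v w, adj u v -> adj u w -> v != w ->
  1 <= `|angle u v - angle u w| <= 5.
Hypothesis deg2 : forall v, (1 < #|[set w | adj v w]|)%N.

Definition nbrs v := [set w | adj v w].
Definition darts := [set d : V * V | adj d.1 d.2].
(** Continues a walk that keeps the face on its right: at the head, turn counterclockwise from the
    contact just used to the next one. *)
Definition face_next (d : V * V) := (d.2, csucc (nbrs d.2) (angle d.2) d.1).
Definition dart_wraps (d : V * V) := wraps (nbrs d.2) (angle d.2) d.1.
(* Angles are measured in units of pi / 3; a full turn is 6. *)
Definition gap (d : V * V) : R :=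
  angle d.2 (face_next d).2 - angle d.2 d.1 + 6 * (dart_wraps d)%:R.

Lemma angle_inj v : {in nbrs v &, injective (angle v)}.
Proof.
move=> a b; rewrite !inE => va vb ab; apply/eqP/negPn/negP => ne.
by have := angle_sep va vb ne; rewrite ab subrr normr0 ler10.
Qed.

Lemma nbrs_dart d : (d.1 \in nbrs d.2) = (d \in darts).
Proof. by rewrite !inE adj_sym. Qed.

Lemma face_next_inj : {in darts &, injective face_next}.
Proof.
move=> [a v] [b w]; rewrite -!nbrs_dart /= => aN bN [vw]; subst w => ab.
by congr pair; apply: csucc_inj ab => //; exact: angle_inj.
Qed.

Lemma gap_ge1 d : d \in darts -> 1 <= gap d.
Proof.
move=> dD; have := dD; rewrite -nbrs_dart => dN; move: (dN); rewrite inE => dA.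
rewrite /gap /dart_wraps /=; case: (csuccP (angle d.2) dN) => b; rewrite inE => db.
  move=> lt _; rewrite mulr0 addr0.
  have ne : b != d.1 by apply: contraTneq lt => ->; rewrite ltxx.
  by have := angle_sep db dA ne; rewrite gtr0_norm ?subr_gt0// => /andP[].
move=> /(_ d.1) amax bmin; have {}bmin := bmin _ dN.
have [->|ne] := eqVneq b d.1; first by rewrite subrr add0r mulr1 ler1n.
have := angle_sep db dA ne; rewrite distrC ger0_norm ?subr_ge0//.
by rewrite mulr1; lra.
Qed.

Lemma sum_gap (B : {set V}) :
  \sum_(d in darts | d.2 \in B) gap d = 6 * #|B|%:R.
Proof.
rewrite -sum1_card natr_sum mulr_sumr mulr1.
rewrite (eq_bigl (fun d : V * V => (d.2 \in B) && (d.1 \in nbrs d.2))); last first.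
  by move=> d; rewrite nbrs_dart andbC.
rewrite (eq_bigr (fun d => gap (d.1, d.2))); last by case.
have := pair_big_dep (mem B) (fun v w => w \in nbrs v) (fun v w => gap (w, v)).
move=> P; transitivity (\sum_(v in B) \sum_(w in nbrs v) gap (w, v)).
  rewrite P (reindex (fun d : V * V => (d.2, d.1))) //=.
  by exists (fun d : V * V => (d.2, d.1)) => -[].
apply: eq_bigr => v _.
have /card_gt0P[w wN] : (0 < #|nbrs v|)%N by exact: ltnW (deg2 v).
by rewrite -[RHS](sum_gaps (@angle_inj v) 6 wN).
Qed.

Variable X : {set V * V}.
Hypothesis XD : X \subset darts.
Hypothesis Xclosed : forall d, d \in X -> face_next d \in X.
Hypothesis Xturn : (#|[set d in X | left d.1 d.2]| < #|[set d in X | dart_wraps d]|)%N.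

Let B := [set d.2 | d in X].

Lemma face_next_X : face_next @: X = X.
Proof.
apply/eqP; rewrite eqEcard card_in_imset ?leqnn ?andbT.
  by apply/fintype.subsetP => _ /imsetP[d dX ->]; apply: Xclosed.
by apply: sub_in2 face_next_inj => d; apply: (fintype.subsetP XD).
Qed.

(* Along a closed set of darts the angles telescope, leaving the reversals and
   the passages through angle 0. *)
Lemma gap_X : 3 * #|X|%:R + 6 <= \sum_(d in X) gap d.
Proof.
have E : \sum_(d in X) gap d = \sum_(d in X) (angle (face_next d).1 (face_next d).2) -
    \sum_(d in X) angle d.1 d.2 + \sum_(d in X) (3 - 6 * (left d.1 d.2)%:R)
    + \sum_(d in X) (6 * (dart_wraps d)%:R).
  rewrite -sumrB -!big_split/=; apply: eq_bigr => d dX; rewrite /gap /=.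
  have := fintype.subsetP XD _ dX; rewrite inE => dA.
  have := angle_rev dA; have := left_anti dA.
  case: (boolP (left d.1 d.2)) => l l' r; first by rewrite r//= mulr1; ring.
  have := adj_sym d.1 d.2; rewrite dA => /esym dA'.
  by rewrite (angle_rev dA') ?l'//= mulr0; ring.
rewrite E -(big_imset (fun d => angle d.1 d.2)) /=; last first.
  by apply: sub_in2 face_next_inj => d; apply: (fintype.subsetP XD).
rewrite face_next_X subrr add0r sumrB -!mulr_sumr.
have cardE (P : pred (V * V)) : \sum_(d in X) (P d)%:R = #|[set d in X | P d]|%:R :> R.
  by rewrite -sum1_card natr_sum [RHS]big_mkcond [LHS]big_mkcond /=;
    apply: eq_bigr => d _; rewrite inE; case: (d \in X); case: (P d).
rewrite (cardE (fun d => left d.1 d.2)) (cardE dart_wraps) sumr_const -mulr_natr.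
have : #|[set d in X | left d.1 d.2]|%:R + 1 <= #|[set d in X | dart_wraps d]|%:R :> R.
  by rewrite natr1 ler_nat.
lra.
Qed.

(** All gaps at vertices of [C] add up to [6 #|C|]; those in [X] account for at least [3 #|X| + 6],
    and each remaining one for at least 1. *)
Lemma gap_lower (C : {set V}) : B \subset C ->
  (2 * #|X| + 6 + #|[set d in darts | d.2 \in C]| <= 6 * #|C|)%N.
Proof.
move=> BC; pose DC := [set d in darts | d.2 \in C].
have XDC : X \subset DC.
  apply/fintype.subsetP => d dX; rewrite inE (fintype.subsetP XD)//=; apply: (fintype.subsetP BC).
  exact: imset_f.
rewrite -(ler_nat R) (natrD _ (_ + _)) (natrD _ (_ * _)) (natrM _ 2) (natrM _ 6).
rewrite -(sum_gap C).
have -> : \sum_(d in darts | d.2 \in C) gap d = \sum_(d in DC) gap d.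
  by apply: eq_bigl => d; rewrite [RHS]inE.
rewrite (big_setID X) /= (finset.setIidPr XDC).
have H : #|DC|%:R - #|X|%:R <= \sum_(d in DC :\: X) gap d.
  rewrite -natrB ?subset_leq_card// -cardsDS// -sum1_card natr_sum.
  apply: ler_sum => d; rewrite !inE => /and3P[_ dD _]; apply: gap_ge1.
  by rewrite inE.
have := gap_X; lra.
Qed.

Lemma boundary_layer : exists B' : {set V},
  [/\ (0 < #|B'|)%N, (#|darts| + 2 * #|B'| + 6 <= 6 * #|V|)%N &
    (#|darts| + 12 <= #|[set d in darts | (d.1 \notin B') && (d.2 \notin B')]| +
       6 * #|B'|)%N].
Proof.
have BX : (#|B| <= #|X|)%N by exact: leq_imset_card.
exists B; split.
- have : (0 < #|X|)%N.
    by apply: leq_ltn_trans (leq_trans Xturn (subset_leq_card _));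
      rewrite ?leq0n//; apply/fintype.subsetP => d; rewrite inE => /andP[].
  by move=> /card_gt0P[d dX]; apply/card_gt0P; exists d.2; exact: imset_f.
- have := gap_lower (finset.subsetT B); rewrite cardsT.
  have -> : [set d in darts | d.2 \in [set: V]] = darts.
    by apply/setP => d; rewrite !inE andbT.
  lia.
have deg := gap_lower (fintype.subxx B).
(* Every boundary vertex has two distinct neighbours in [B]: its predecessor and its successor along
   the face walk. *)
have both : (2 * #|B| <= #|[set d in darts | (d.1 \in B) && (d.2 \in B)]|)%N.
  rewrite -[X in (_ <= X)%N]sum1_card.
  rewrite (eq_bigl (fun d : V * V => (d.1 \in B) && ((d.2 \in nbrs d.1) && (d.2 \in B))));
    last by move=> d; rewrite !inE; case: (adj _ _); rewrite ?andbF.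
  rewrite -(pair_big_dep (mem B) (fun v w => (w \in nbrs v) && (w \in B)) (fun _ _ => 1%N)) /=.
  rewrite mulnC -sum_nat_const; apply: leq_sum => v /imsetP[d dX ->].
  rewrite sum1_card; have dN : d.1 \in nbrs d.2 by rewrite nbrs_dart (fintype.subsetP XD).
  have dB : d.1 \in B.
    move: dX; rewrite -face_next_X => /imsetP[d' d'X ->].
    exact: imset_f.
  have wB : (face_next d).2 \in B by exact/imset_f/Xclosed.
  have := csucc_neq (@angle_inj d.2) (deg2 d.2) dN => ne.
  have -> : 2%N = #|[set d.1; (face_next d).2]| by rewrite cards2 eq_sym ne.
  apply: subset_leq_card; apply/fintype.subsetP => w; rewrite in_set2.
  case/orP=> /eqP -> ; rewrite unfold_in ?dN ?dB ?wB ?andbT//.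
  exact: csucc_in.
pose o := [set d in darts | (d.1 \notin B) && (d.2 \notin B)].
pose i2 := [set d in darts | d.2 \in B].
pose i1 := [set d in darts | d.1 \in B].
have i12 : #|i1| = #|i2|.
  rewrite -(card_imset i1 (f := fun d => (d.2, d.1))); last by move=> [? ?] [? ?] [-> ->].
  apply: eq_card => -[a b]; apply/imsetP/idP => [[[c d]]|].
    by rewrite !inE /= => /andP[? ?] [-> ->]; rewrite adj_sym; apply/andP.
  by rewrite !inE /= => ?; exists (b, a); rewrite ?inE //= adj_sym.
(* Inclusion-exclusion over tail and head in [B]; combined with [deg], [both] and [BX] it bounds the
   contacts lost with the layer. *)
have : (#|darts| + #|[set d in darts | (d.1 \in B) && (d.2 \in B)]| = #|o| + #|i1| + #|i2|)%N.
  rewrite -!sum1_card.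
  have E (P : pred (V * V)) : (\sum_(d in [set d in darts | P d]) 1 = \sum_(d in darts) P d)%N.
    by rewrite big_mkcond [RHS]big_mkcond /=; apply: eq_bigr => d _;
      rewrite inE; case: (d \in darts); case: (P d).
  rewrite !E (_ : \sum_(d in darts) 1 = \sum_(d in darts) xpredT d)%N; last by apply: eq_bigr.
  by rewrite -!big_split; apply: eq_bigr => d _ /=; case: (d.1 \in B); case: (d.2 \in B).
rewrite i12 -/i2 -/o in deg *; lia.
Qed.

End Counting.

(** * Sweeping a contact graph *)

(** For unit vectors [(q' p)^2 - (q p')^2 = q'^2 - q^2], so slopes compare like ordinates once the
    signs are split. *)
Lemma unit_slope (R : realFieldType) (a b c d : R) : 0 < a -> 0 < c ->
  a ^+ 2 + b ^+ 2 = 1 -> c ^+ 2 + d ^+ 2 = 1 -> (b / a < d / c) = (b < d).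
Proof.
have H (p q p' q' : R) : 0 < p -> 0 < p' -> p ^+ 2 + q ^+ 2 = 1 ->
    p' ^+ 2 + q' ^+ 2 = 1 -> q < q' -> q * p' < q' * p.
  move=> p0 p'0 pq pq' qq'.
  have E : (q' * p) ^+ 2 - (q * p') ^+ 2 = q' ^+ 2 - q ^+ 2.
    rewrite !exprMn -[p ^+ 2](addrK (q ^+ 2)) -[p' ^+ 2](addrK (q' ^+ 2)) pq pq'.
    ring.
  have [q0|q0] := leP 0 q.
    have q'0 := le_lt_trans q0 qq'.
    rewrite -ltr_sqr ?nnegrE ?mulr_ge0 ?(ltW p0) ?(ltW p'0) ?(ltW q'0)//.
    by rewrite -subr_gt0 E subr_gt0 ltr_sqr ?nnegrE// ltW.
  have [q'0|q'0] := ltP 0 q'.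
    by rewrite (@lt_trans _ _ 0)// ?nmulr_rlt0 ?mulr_gt0.
  have q1 : 0 <= - (q * p') by rewrite oppr_ge0 nmulr_rle0// ltW.
  have q1' : 0 <= - (q' * p) by rewrite oppr_ge0 mulr_le0_ge0// ltW.
  rewrite -ltrN2 -(ltr_sqr q1' q1) !sqrrN -subr_lt0 E subr_lt0.
  by rewrite -[q' ^+ 2]sqrrN -[q ^+ 2]sqrrN ltr_sqr ?nnegrE ?oppr_ge0 ?ltrN2// ltW.
move=> a0 c0 ab cd; rewrite ltr_pdivrMr// mulrAC ltr_pdivlMr//.
case: (ltgtP b d) => bd; first exact: H.
  by rewrite lt_gtF// H.
suff -> : a = c by rewrite bd ltxx.
apply/eqP; rewrite -(@eqrXn2 _ 2) ?ltW//.
by apply/eqP/(addIr (b ^+ 2)); rewrite ab bd.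
Qed.

Section Penny.
Variables (R : realFieldType) (n : nat) (x y : nat -> R).

Definition dist2 (i j : nat) : R := (x i - x j) ^+ 2 + (y i - y j) ^+ 2.

Definition contact (i j : 'I_n) := dist2 i j == 1.

Definition isedge (e : 'I_n * 'I_n) := (e.1 < e.2)%N && contact e.1 e.2.

Definition edge_height (e : 'I_n * 'I_n) (t : R) : R :=
  y e.1 + (y e.2 - y e.1) * ((t - x e.1) / (x e.2 - x e.1)).

(* Vertices are sorted by abscissa; slab [s] lies between the abscissas of
   vertices [s - 1] and [s]. *)
Definition spans (s : nat) (e : 'I_n * 'I_n) := isedge e && (e.1 < s <= e.2)%N.

Definition mid (s : nat) : R := (x s.-1 + x s) / 2.

Hypothesis xinc : forall i j, (i < j < n)%N -> x i < x j.
Hypothesis penny : forall i j : 'I_n, i != j -> 1 <= dist2 i j.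

Local Notation ht := edge_height.

Lemma contact_sym i j : contact i j = contact j i.
Proof. by rewrite /contact /dist2 -[x i - x j]opprB -[y i - y j]opprB !sqrrN. Qed.

Lemma ltx (i j : 'I_n) : (x i < x j) = (i < j)%N.
Proof.
have inc (u v : 'I_n) : (u < v)%N -> x u < x v.
  by move=> uv; apply: xinc; rewrite uv ltn_ord.
apply/idP/idP => [|/inc//]; case: (ltngtP i j) => // [/inc ji|->].
  by move=> /(lt_trans ji); rewrite ltxx.
by rewrite ltxx.
Qed.

Lemma edge_lt e : isedge e -> x e.1 < x e.2.
Proof. by case/andP=> e12 _; rewrite ltx. Qed.

Lemma height_l e : ht e (x e.1) = y e.1.
Proof. by rewrite /ht subrr mul0r mulr0 addr0. Qed.

Lemma height_r e : isedge e -> ht e (x e.2) = y e.2.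
Proof.
move=> /edge_lt le; rewrite /ht divff ?mulr1 ?subrKC//.
by rewrite subr_eq0 gt_eqF.
Qed.

Lemma height_param e t : isedge e -> x e.1 <= t <= x e.2 ->
  exists2 l, 0 <= l <= 1 & t = x e.1 + l * (x e.2 - x e.1) /\
    ht e t = y e.1 + l * (y e.2 - y e.1).
Proof.
move=> /edge_lt le /andP[t1 t2].
have d0 : 0 < x e.2 - x e.1 by rewrite subr_gt0.
exists ((t - x e.1) / (x e.2 - x e.1)).
  apply/andP; split; first by rewrite divr_ge0 ?subr_ge0 ?(ltW le).
  by rewrite ler_pdivrMr// mul1r; lra.
by rewrite divfK ?gt_eqF// subrKC /ht mulrC.
Qed.

(** Bias-variance identity: the weighted mean squared distance between endpoints is the sum of the
    two variances and the squared distance of the barycentres. *)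
Lemma cross_distances (a b c d a' b' c' d' l m : R) :
  (1 - l) * (1 - m) * ((a - c) ^+ 2 + (a' - c') ^+ 2) +
  l * m * ((b - d) ^+ 2 + (b' - d') ^+ 2) +
  (1 - l) * m * ((a - d) ^+ 2 + (a' - d') ^+ 2) +
  l * (1 - m) * ((b - c) ^+ 2 + (b' - c') ^+ 2) =
  l * (1 - l) * ((a - b) ^+ 2 + (a' - b') ^+ 2) +
  m * (1 - m) * ((c - d) ^+ 2 + (c' - d') ^+ 2) +
  (a + l * (b - a) - (c + m * (d - c))) ^+ 2 +
  (a' + l * (b' - a') - (c' + m * (d' - c'))) ^+ 2.
Proof. ring. Qed.

(* The four distances between endpoints of two segments meeting in a point,
   weighted by its barycentric coordinates, average to
   l (1 - l) + m (1 - m) <= 1/2, so two contacts never cross. *)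
Lemma edge_meet e e' t : isedge e -> isedge e' -> e != e' ->
  x e.1 <= t <= x e.2 -> x e'.1 <= t <= x e'.2 -> ht e t = ht e' t ->
  exists v : 'I_n, [/\ t = x v, v \in [:: e.1; e.2] & v \in [:: e'.1; e'.2]].
Proof.
move=> E E' ne te te'.
have [l /andP[l0 l1] [tl ->]] := height_param E te.
have [m /andP[m0 m1] [tm ->]] := height_param E' te'.
case/andP: (E) => _ /eqP; case/andP: (E') => _ /eqP.
move: (penny (i := e.1) (j := e'.1)) (penny (i := e.1) (j := e'.2)).
move: (penny (i := e.2) (j := e'.1)) (penny (i := e.2) (j := e'.2)).
have := cross_distances (x e.1) (x e.2) (x e'.1) (x e'.2)
  (y e.1) (y e.2) (y e'.1) (y e'.2) l m.
rewrite -/(dist2 e.1 e'.1) -/(dist2 e.2 e'.2) -/(dist2 e.1 e'.2)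
  -/(dist2 e.2 e'.1) -/(dist2 e.1 e.2) -/(dist2 e'.1 e'.2) => + P21 P22 P11 P12.
move=> + C' C H; rewrite C C' H -tl -tm !subrr expr0n/= !mulr1 !addr0.
have w11 : 0 <= (1 - l) * (1 - m) by rewrite mulr_ge0// subr_ge0.
have w22 : 0 <= l * m by rewrite mulr_ge0.
have w12 : 0 <= (1 - l) * m by rewrite mulr_ge0// subr_ge0.
have w21 : 0 <= l * (1 - m) by rewrite mulr_ge0// subr_ge0.
have scale (w d : R) (b : bool) : 0 <= w -> (b -> 1 <= d) -> b -> w <= w * d.
  by move=> ? h /h hd; rewrite ler_peMr.
(* If the edges share their left end, the averaged inequality reduces to this with [(l, m)]; if they
   share their right end, with [(1 - l, 1 - m)]. *)
have zero (a b : R) : a ^+ 2 + b ^+ 2 <= a * b -> a = 0.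
  by move=> ab; apply/eqP; rewrite -sqrf_eq0; apply/eqP; nra.
move: P22 P21 P12 P11 => /(scale _ _ _ w22) P22 /(scale _ _ _ w21) P21
  /(scale _ _ _ w12) P12 /(scale _ _ _ w11) P11 I.
(* When the left end of one edge is the right end of the other, their abscissa ranges have only that
   vertex in common. *)
case: (eqVneq e.1 e'.2) => [e12|n12].
  exists e.1; rewrite !inE e12 !eqxx ?orbT; split=> //.
  by apply/eqP; rewrite eq_le -e12; move: te te'; rewrite -e12; lra.
case: (eqVneq e.2 e'.1) => [e21|n21].
  exists e.2; rewrite !inE e21 !eqxx ?orbT; split=> //.
  by apply/eqP; rewrite eq_le -e21; move: te te'; rewrite -e21; lra.
have {}P21 := P21 n21; have {}P12 := P12 n12.
case: (eqVneq e.1 e'.1) => [e11|n11].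
  have n22 : e.2 != e'.2.
    by apply: contraNneq ne => e22; rewrite [e]surjective_pairing e11 e22 -surjective_pairing.
  exists e.1; rewrite !inE e11 !eqxx; split=> //.
  have {}P22 := P22 n22.
  suff l00 : l = 0 by rewrite tl l00 mul0r addr0 e11.
  move: I P21; rewrite {1}/dist2 -e11 !subrr expr0n /= addr0 mulr0 add0r => I P21.
  by apply: (zero _ m); rewrite !expr2; lra.
case: (eqVneq e.2 e'.2) => [e22|n22].
  exists e.2; rewrite !inE e22 !eqxx ?orbT; split=> //.
  suff l00 : l = 1 by rewrite tl l00 mul1r subrKC e22.
  move: I P12; rewrite {2}/dist2 -e22 !subrr expr0n /= addr0 mulr0 addr0 => I P12.
  have {}P11 := P11 n11; apply/esym/eqP; rewrite -subr_eq0; apply/eqP.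
  by apply: (zero _ (1 - m)); rewrite !expr2; lra.
exfalso; have {}P11 := P11 n11; have {}P22 := P22 n22.
have := sqr_ge0 (l - 2^-1); have := sqr_ge0 (m - 2^-1).
by rewrite !expr2; lra.
Qed.

(** A vertex on the edge would lie at distance [l <= 1] from the left end; the penny condition
    forces [l = 1], hence the abscissa of the right end. *)
Lemma height_vertex e (v : 'I_n) : isedge e -> (e.1 < v < e.2)%N ->
  edge_height e (x v) != y v.
Proof.
move=> E /andP[e1 e2]; apply/eqP => H.
have te : x e.1 <= x v <= x e.2 by rewrite !ltW// ltx.
have [l /andP[l0 l1] [tl]] := height_param E te; rewrite H => yl.
have ne1 : v != e.1 by apply: contraTneq e1 => ->; rewrite ltnn.
have := penny ne1; case/andP: (E) => _ /eqP; rewrite /dist2 => C.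
have -> : x v - x e.1 = l * (x e.2 - x e.1) by rewrite tl addrC addKr.
have -> : y v - y e.1 = l * (y e.2 - y e.1) by rewrite yl addrC addKr.
have -> : (l * (x e.2 - x e.1)) ^+ 2 + (l * (y e.2 - y e.1)) ^+ 2 = l ^+ 2.
  by rewrite -[RHS]mulr1 -C; ring.
move=> l2; have {l2}l1' : l = 1 by apply/eqP; rewrite eq_le l1; nra.
have : x v < x e.2 by rewrite ltx.
by rewrite tl l1' mul1r subrKC ltxx.
Qed.

Lemma height_affine e t t' c : isedge e ->
  ht e (t + c * (t' - t)) = ht e t + c * (ht e t' - ht e t).
Proof.
move=> /edge_lt le; rewrite /ht.
by field; rewrite subr_eq0 gt_eqF.
Qed.

Lemma mid_bounds s : (0 < s < n)%N -> x s.-1 < mid s < x s.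
Proof.
move=> /andP[s0 sn].
have : x s.-1 < x s by apply: xinc; rewrite sn prednK ?leqnn.
by rewrite /mid => ?; apply/andP; split; lra.
Qed.

Lemma spans_index s e : spans s e -> (0 < s < n)%N.
Proof.
case/andP=> _ /andP[e1 e2]; rewrite (leq_ltn_trans _ e1)//=.
exact: leq_ltn_trans e2 (ltn_ord _).
Qed.

Lemma lex (i j : nat) : (i < n)%N -> (j < n)%N -> (i <= j)%N -> x i <= x j.
Proof.
move=> ni nj; rewrite leq_eqVlt => /orP[/eqP ->//|ij].
by rewrite ltW// xinc// ij.
Qed.

Lemma spans_dom s e t : spans s e -> x s.-1 <= t <= x s ->
  x e.1 <= t <= x e.2.
Proof.
move=> S; have /andP[s0 sn] := spans_index S.
case/andP: S => _ /andP[e1 e2] /andP[t1 t2]; apply/andP; split.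
  apply: le_trans t1; apply: lex; rewrite ?ltn_ord//; lia.
by apply: le_trans t2 _; apply: lex; rewrite ?ltn_ord.
Qed.

Lemma spans_neq s e e' t : spans s e -> spans s e' -> e != e' ->
  x s.-1 < t < x s -> ht e t != ht e' t.
Proof.
move=> S S' ne /andP[t1 t2]; apply/eqP => H.
have tt : x s.-1 <= t <= x s by rewrite !ltW.
have [v [tv _ _]] := edge_meet (proj1 (andP S)) (proj1 (andP S')) ne
  (spans_dom S tt) (spans_dom S' tt) H.
have /andP[s0 sn] := spans_index S.
move: t1 t2; rewrite tv.
have s1n : (s.-1 < n)%N by lia.
rewrite -[s.-1]/(nat_of_ord (Ordinal s1n)) -[s]/(nat_of_ord (Ordinal sn)).
by rewrite !ltx /=; lia.
Qed.

(** One abscissa per slab is enough: distinct spanning edges do not meet inside it, so their order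
    is constant there. *)
Definition lower s e e' := ht e (mid s) < ht e' (mid s).

Lemma lower_total s e e' : spans s e -> spans s e' ->
  [|| e == e', lower s e e' | lower s e' e].
Proof.
move=> S S'; case: eqVneq => //= ne; rewrite -neq_lt.
exact: spans_neq S S' ne (mid_bounds (spans_index S)).
Qed.

(** If the order on the border of the slab differed from the one in the middle, the two affine
    heights would agree at an interior abscissa. *)
Lemma lower_end s e e' (v : nat) : spans s e -> spans s e' ->
  v = s.-1 \/ v = s -> ht e (x v) < ht e' (x v) -> lower s e e'.
Proof.
move=> S S' vs h.
have ne : e != e' by apply: contraTneq h => ->; rewrite ltxx.
case/or3P: (lower_total S S') => // [/idPn[]//|L]; exfalso.
have /andP[m1 m2] := mid_bounds (spans_index S).
move: L; rewrite /lower; set m := mid s in m1 m2 * => L.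
pose D := ht e' (x v) - ht e (x v); pose M := ht e m - ht e' m.
have D0 : 0 < D by rewrite subr_gt0.
have M0 : 0 < M by rewrite subr_gt0.
(* Zero of the affine height difference, which is [D] on the border and [- M] in the middle. *)
pose c := D / (D + M).
have DM : 0 < D + M by rewrite addr_gt0.
have c0 : 0 < c by rewrite divr_gt0.
have c1 : c < 1 by rewrite ltr_pdivrMr// mul1r ltrDl.
have E : ht e (x v + c * (m - x v)) = ht e' (x v + c * (m - x v)).
  rewrite !height_affine ?(proj1 (andP S)) ?(proj1 (andP S'))//.
  apply/eqP; rewrite -subr_eq0.
  have -> : ht e (x v) + c * (ht e m - ht e (x v)) -
    (ht e' (x v) + c * (ht e' m - ht e' (x v))) = c * (D + M) - D.
    by rewrite /D /M; ring.
  by rewrite divfK ?subrr// gt_eqF.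
move: E; apply/eqP/(spans_neq S S' ne).
by case: vs => ->; apply/andP; split; nra.
Qed.

Definition crosses (v : nat) e := isedge e && (e.1 < v < e.2)%N.

(** Vertex [v] is the right border of slab [v] and the left border of slab [v.+1]. *)
Definition beside (v s : nat) := (s == v) || (s == v.+1).

Lemma crosses_spans v s e : beside v s -> crosses v e -> spans s e.
Proof.
rewrite /beside /spans => sv /andP[-> /andP[e1 e2]] /=.
by case/orP: sv => /eqP ->; lia.
Qed.

Lemma spans_crosses v s e : beside v s -> spans s e ->
  crosses v e \/ edge_height e (x v) = y v.
Proof.
rewrite /crosses => sv /andP[E e12]; rewrite E /=.
case/orP: sv => /eqP sv; rewrite sv in e12.
  have [->|nv] := eqVneq v e.2; [by right; exact: height_r|left].
  by move/eqP: nv; lia.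
have [->|nv] := eqVneq v e.1; [by right; exact: height_l|left].
by move/eqP: nv; lia.
Qed.

Lemma crosses_neq (v : 'I_n) e : crosses v e -> ht e (x v) != y v.
Proof. by case/andP=> E v12; apply: height_vertex. Qed.

Lemma crosses_neq2 (v : 'I_n) e e' : crosses v e -> crosses v e' -> e != e' ->
  ht e (x v) != ht e' (x v).
Proof.
move=> /andP[E /andP[e1 e2]] /andP[E' /andP[e1' e2']] ne; apply/eqP => H.
have le (i j : 'I_n) : (i < j)%N -> x i <= x j by rewrite -ltx => /ltW.
have [||w [/eqP]] := edge_meet E E' ne _ _ H; rewrite ?le//.
rewrite !inE => xw ew _; suff vw : v = w.
  by move: ew e1 e2; rewrite vw => /orP[] /eqP ->; rewrite ltnn.
apply/val_inj/eqP; rewrite eqn_leq leqNgt -ltx [X in _ && X]leqNgt -ltx.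
by rewrite (eqP xw) ltxx.
Qed.

Lemma lower_at s v e e' : beside v s -> spans s e -> spans s e' ->
  lower s e e' -> ht e (x v) <= ht e' (x v).
Proof.
move=> sv S S' L; rewrite leNgt; apply/negP => H.
have : lower s e' e.
  by apply: lower_end H => //; case/orP: sv => /eqP ->; [right|left].
by move=> /(lt_trans L); rewrite ltxx.
Qed.

Lemma lower_beside s v e e' : beside v s -> spans s e -> spans s e' ->
  ht e (x v) < ht e' (x v) -> lower s e e'.
Proof.
by move=> sv S S'; apply: lower_end => //; case/orP: sv => /eqP ->; [right|left].
Qed.

Lemma lower_cross s (v : 'I_n) e e' : beside v s -> crosses v e -> crosses v e' ->
  lower s e e' = (ht e (x v) < ht e' (x v)).
Proof.
move=> sv C C'; have S := crosses_spans sv C; have S' := crosses_spans sv C'.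
apply/idP/idP => [L|]; last exact: lower_beside.
rewrite lt_neqAle (lower_at sv)// andbT.
by apply: crosses_neq2 => //; apply: contraTneq L => ->; rewrite /lower ltxx.
Qed.

Definition top s (P : pred ('I_n * 'I_n)) : option ('I_n * 'I_n) :=
  [pick e | (spans s e && P e) &&
    [forall e', (spans s e' && P e') ==> ((e' == e) || lower s e' e)]].

Variant top_spec s (P : pred ('I_n * 'I_n)) : option ('I_n * 'I_n) -> Type :=
| TopSome e of spans s e & P e &
    (forall e', spans s e' -> P e' -> (e' == e) || lower s e' e) :
    top_spec s P (Some e)
| TopNone of (forall e, spans s e -> ~~ P e) : top_spec s P None.

Lemma topP s P : top_spec s P (top s P).
Proof.
rewrite /top; case: pickP => [e /andP[/andP[S Pe] /forallP H]|H].
  by constructor=> // e' S' P'; have := H e'; rewrite S' P'.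
constructor=> e0 S0; apply/negP => P0.
have SP0 : spans s e0 && P e0 by rewrite S0.
case: (@arg_maxP _ _ _ e0 (fun e => spans s e && P e)
  (fun e => ht e (mid s)) SP0) => e /andP[S Pe] emax.
have /negP[] := negbT (H e); rewrite S Pe /=; apply/forallP => e'.
apply/implyP => /andP[S' P']; case/or3P: (lower_total S S') => [/eqP->||->].
- by rewrite eqxx.
- by rewrite /lower ltNge => /negP[]; apply: emax; rewrite S'.
- by rewrite orbT.
Qed.

Lemma top_some s (P : pred ('I_n * 'I_n)) e : spans s e -> P e ->
  (forall e', spans s e' -> P e' -> (e' == e) || lower s e' e) ->
  top s P = Some e.
Proof.
move=> S Pe emax; case: topP => [e' S' P' emax'|/(_ e S)/negP//].
congr Some; have := emax _ S' P'; have := emax' _ S Pe.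
rewrite [e == e']eq_sym; case: (eqVneq e' e) => //= _ L /(lt_trans L).
by rewrite ltxx.
Qed.

Lemma eq_top s (P Q : pred ('I_n * 'I_n)) :
  (forall e, spans s e -> P e = Q e) -> top s P = top s Q.
Proof.
move=> PQ; case: (topP s Q) => [e S Qe emax|H].
  by apply: top_some; rewrite ?PQ// => e' S'; rewrite PQ//; apply: emax.
by case: topP => // e S; rewrite PQ// (negbTE (H _ S)).
Qed.

(** If only edges crossing [v] qualify, the two slabs at [v] give the same answer, since crossing
    edges keep their order. *)
Lemma top_transfer s s' (v : 'I_n) (P Q : pred ('I_n * 'I_n)) :
  beside v s -> beside v s' ->
  (forall e, spans s e -> P e -> crosses v e /\ Q e) ->
  (forall e, spans s' e -> Q e -> crosses v e /\ P e) ->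
  top s P = top s' Q.
Proof.
move=> sv sv' PQ QP; case: (topP s' Q) => [e S Qe emax|H].
  have [C Pe] := QP _ S Qe.
  apply: top_some => //; first exact: (crosses_spans sv).
  move=> e' S' /(PQ _ S')[C' Qe'].
  by rewrite (lower_cross sv)// -(lower_cross sv')// emax// (crosses_spans sv').
case: topP => // e S Pe _; have [C Qe] := PQ _ S Pe.
by have := H _ (crosses_spans sv' C); rewrite Qe.
Qed.

(** * Cells of the sweep and the component of the unbounded cell *)

Definition under s (u : option ('I_n * 'I_n)) e :=
  if u is Some u' then lower s e u' else true.

(** The cell directly underneath [u]; for [u = None] this is the uppermost cell of the slab. *)
Definition below s u := top s (under s u).

(* The cell containing the space just above [v], seen from the left and from the
   right of [v]; a cell is named by the edge bounding it from below. *)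
Definition lam (v : 'I_n) := top v (fun e => ht e (x v) <= y v).

Definition rho (v : 'I_n) := top v.+1 (fun e => ht e (x v) <= y v).

(** The cell containing the space just below [v]: the strict inequality excludes the edges ending at
    [v]. *)
Definition floor_at (v : 'I_n) s := top s (fun e => ht e (x v) < y v).

Lemma beside_l v : beside v v. Proof. by rewrite /beside eqxx. Qed.
Lemma beside_r v : beside v v.+1. Proof. by rewrite /beside eqxx orbT. Qed.

Lemma floor_at_lr v : floor_at v v = floor_at v v.+1.
Proof.
apply: (top_transfer (beside_l v) (beside_r v)) => e S h.
  by have [//|e0] := spans_crosses (beside_l v) S; move: h; rewrite e0 ltxx.
by have [//|e0] := spans_crosses (beside_r v) S; move: h; rewrite e0 ltxx.
Qed.

(** When the sweep passes [v], the cell directly under [u] can change only if [v] lies below [u]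
    with no crossing edge in between. *)
Lemma below_step (v : 'I_n) (u : option ('I_n * 'I_n)) :
  (if u is Some e then crosses v e else true) ->
  below v u = below v.+1 u \/ (below v u = lam v /\ below v.+1 u = rho v).
Proof.
move=> Cu.
pose above_u e := if u is Some u' then ht e (x v) < ht u' (x v) else true.
have lowE s e : beside v s -> crosses v e -> under s u e = above_u e.
  by rewrite /under /above_u => sv; clear above_u; case: u Cu => // u' Cu C; exact: lower_cross.
(* Here [v] lies above [u], so all edges under [u] cross [v]. *)
have [uv|nuv] := boolP (if u is Some u' then ht u' (x v) < y v else false).
  left; apply: (top_transfer (beside_l v) (beside_r v)) => e S U.
    have [C|e0] := spans_crosses (beside_l v) S.
      by rewrite (lowE _ _ (beside_r v))// -(lowE v)// beside_l.
    clear lowE above_u; case: u Cu uv U => // u' Cu uv U.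
    have := lower_at (beside_l v) S (crosses_spans (beside_l v) Cu) U.
    by rewrite e0 leNgt uv.
  have [C|e0] := spans_crosses (beside_r v) S.
    by rewrite (lowE _ _ (beside_l v))// -(lowE v.+1)// beside_r.
  clear lowE above_u; case: u Cu uv U => // u' Cu uv U.
  have := lower_at (beside_r v) S (crosses_spans (beside_r v) Cu) U.
  by rewrite e0 leNgt uv.
(* Crossing edges strictly between [v] and [u]; the highest of them bounds the cell on both sides of
   [v]. *)
pose C e := [&& crosses v e, above_u e & y v < ht e (x v)].
have [/existsP[e0 Ce0]|ne] := boolP [exists e, C e].
  left; case: (@arg_maxP _ _ _ e0 C (fun e => ht e (x v)) Ce0) => e /and3P[Ce ue ev] emax.
  suff H s : beside v s -> below s u = Some e by rewrite !H ?beside_l ?beside_r.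
  move=> sv; apply: top_some; [exact: (crosses_spans sv)|by rewrite lowE|].
  move=> e' S' U'; case: (eqVneq e' e) => //= e'e.
  apply: (lower_beside sv) => //; first exact: (crosses_spans sv).
  have [C'|->//] := spans_crosses sv S'.
  rewrite lt_neqAle crosses_neq2//=.
  case: (ltP (y v) (ht e' (x v))) => [ye|ey]; last exact: ltW (le_lt_trans ey ev).
  by apply: emax; rewrite /C C' ye -(lowE s)// U'.
(* Nothing separates [v] from [u], so the cell under [u] is the space just above [v]. *)
suff H s : beside v s -> below s u = top s (fun e => ht e (x v) <= y v).
  by right; rewrite !H ?beside_l ?beside_r.
move=> sv; apply: eq_top => e S; apply/idP/idP => [U|ey].
  have [Cr|->//] := spans_crosses sv S; rewrite leNgt; apply/negP => ye.
  by case/existsP: ne; exists e; rewrite /C Cr ye -(lowE s)// U.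
clear lowE ne C above_u; case: u Cu nuv => //= u' Cu; rewrite -leNgt => yu.
apply: (lower_beside sv) => //; first exact: (crosses_spans sv).
apply: le_lt_trans ey _; rewrite lt_neqAle yu andbT eq_sym.
exact: crosses_neq.
Qed.

Hypothesis n0 : (0 < n)%N.

(* [None] is the unbounded cell: each vertex joins the cells [lam v] and
   [rho v], and every vertex but the leftmost one is used to enlarge [Y]
   maximally; the leftmost vertex then comes for free, as it closes a cycle
   around the configuration. *)
Lemma exterior_cells : exists Y : {set option ('I_n * 'I_n)},
  [/\ None \in Y, (forall v, (lam v \in Y) = (rho v \in Y)) &
    (#|Y| <= #|[set v | lam v \in Y]|)%N].
Proof.
pose v0 := Ordinal n0.
pose V (Y : {set option ('I_n * 'I_n)}) :=
  [set v | [&& v != v0, lam v \in Y & rho v \in Y]].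
pose T (Y : {set option ('I_n * 'I_n)}) := (None \in Y) && (#|Y| <= #|V Y| + 1)%N.
have T0 : T [set None] by rewrite /T set11 cards1 addn1.
case: (arg_maxnP (fun Y : {set option ('I_n * 'I_n)} => #|Y|) T0).
move=> Y /andP[NY cY] Ymax.
(* Adding the cell [z] raises the size by one and gains at least the vertex [v], so the constraint
   survives and maximality is contradicted. *)
have grow v z : v != v0 -> z \notin Y -> (lam v \in z |: Y) && (rho v \in z |: Y) ->
    (lam v \in Y) && (rho v \in Y) = false -> False.
  move=> vv0 zY inY ninY.
  suff /Ymax /= : T (z |: Y) by rewrite cardsU1 zY /=; lia.
  rewrite /T inE NY orbT /= cardsU1 zY.
  have sub : V Y \subset V (z |: Y) :\ v.
    apply/fintype.subsetP => w; rewrite !inE => /and3P[-> lw rw].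
    rewrite lw rw !orbT !andbT; apply: contraFneq ninY => <-.
    by rewrite lw rw.
  have /subset_leq_card := sub.
  rewrite (cardsD1 v (V (z |: Y))) inE vv0 inY /=.
  by move: cY; rewrite /=; lia.
have Hn0 v : v != v0 -> (lam v \in Y) = (rho v \in Y).
  move=> vv0; have [lY|lY] := boolP (lam v \in Y); have [rY|rY] := boolP (rho v \in Y) => //.
    exfalso; apply: (grow v (rho v)) => //; rewrite ?(negbTE rY) ?andbF//.
    by rewrite !inE lY eqxx orbT.
  exfalso; apply: (grow v (lam v)) => //; rewrite ?(negbTE lY)//.
  by rewrite !inE rY eqxx orbT.
have lam0 : lam v0 = None.
  by rewrite /lam; case: topP => // e /spans_index.
(* Sweep from right to left along the uppermost cells, starting from slab [n], which no edge spans;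
   the leftmost vertex is never passed, so [Hn0] suffices. *)
have Hb k : (k < n)%N -> below (n - k) None \in Y.
  elim: k => [_|k IH kn].
    by rewrite /below; case: topP => // e /spans_index; rewrite subn0 ltnn andbF.
  have vn : (n - k.+1 < n)%N by lia.
  have := @below_step (Ordinal vn) None isT.
  rewrite /= -subSn; last by lia.
  rewrite subSS => -[->|[-> e]]; first by apply: IH; lia.
  rewrite Hn0; first by rewrite -e; apply: IH; lia.
  by rewrite -val_eqE /=; lia.
have rho0 : rho v0 \in Y.
  have := Hb n.-1; rewrite (_ : n - n.-1 = v0.+1)%N /=; last lia.
  rewrite /below /rho => /(_ ltac:(lia)); congr (_ \in Y).
  apply: eq_top => e /andP[E /andP[e1 _]]; apply/esym.
  have -> : v0 = e.1 by apply: val_inj => /=; lia.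
  by rewrite height_l lexx.
exists Y; split=> // [v|].
  by have [->|/Hn0//] := eqVneq v v0; rewrite lam0 NY rho0.
apply: leq_trans cY _; rewrite addn1.
rewrite (cardsD1 v0 [set v | _]) inE lam0 NY /= add1n ltnS.
by apply/subset_leq_card/fintype.subsetP => w; rewrite !inE => /and3P[-> ->].
Qed.


(** * Exterior darts and their rotation around vertices *)

Variable angle : 'I_n -> 'I_n -> R.
Hypothesis angle_left : forall v w, contact v w -> (w < v)%N = (angle v w < 3).
Hypothesis angle_rev : forall v w, contact v w -> (w < v)%N ->
  angle w v = angle v w + 3.
Hypothesis angle_sep : forall u v w, contact u v -> contact u w -> v != w ->
  1 <= `|angle u v - angle u w| <= 5.
Hypothesis angle_y : forall v u w, contact v u -> contact v w ->
  (u < v)%N = (w < v)%N ->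
  (angle v u < angle v w) = (if (u < v)%N then y w < y u else y u < y w).

Lemma contact_neq v w : contact v w -> v != w.
Proof.
apply: contraTneq => ->; rewrite /contact /dist2 !subrr expr0n addr0.
by rewrite eq_sym oner_eq0.
Qed.

Lemma spans_l (v : 'I_n) e : spans v e ->
  crosses v e \/ exists w, [/\ e = (w, v), contact v w & (w < v)%N].
Proof.
case: e => w u /andP[/andP[/= wu c] /andP[/= wv]]; rewrite leq_eqVlt.
case/orP => [/eqP/val_inj vu|vu]; [right|left; apply/and3P; split=> //=; exact/andP].
by exists w; rewrite vu contact_sym.
Qed.

Lemma spans_r (v : 'I_n) e : spans v.+1 e ->
  crosses v e \/ exists w, [/\ e = (v, w), contact v w & (v < w)%N].
Proof.
case: e => u w /andP[/andP[/= uw c] /andP[/=]]; rewrite ltnS leq_eqVlt.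
case/orP => [/eqP/val_inj vu vw|vu vw]; [right|left; apply/and3P; split=> //=; exact/andP].
by exists w; rewrite -vu.
Qed.

Lemma edge_l (v w : 'I_n) : contact v w -> (w < v)%N -> spans v (w, v).
Proof. by move=> c wv; rewrite /spans /isedge/= wv contact_sym c leqnn. Qed.

Lemma edge_r (v w : 'I_n) : contact v w -> (v < w)%N -> spans v.+1 (v, w).
Proof. by move=> c wv; rewrite /spans /isedge/= wv c ltnSn. Qed.

Lemma contact_unit v w : contact v w ->
  (x v - x w) ^+ 2 + (y v - y w) ^+ 2 = 1.
Proof. by move/eqP. Qed.

(** Near [v] heights are ordered by slope, hence by ordinate for unit edges; with angles
    counterclockwise from the upward direction, a larger angle on the left is lower. *)
Lemma lower_l (v u w : 'I_n) : contact v u -> contact v w ->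
  (u < v)%N -> (w < v)%N -> lower v (w, v) (u, v) = (angle v u < angle v w).
Proof.
move=> cu cw uv wv; rewrite angle_y ?uv ?wv//.
have /andP[_ mv] := mid_bounds (spans_index (edge_l cu uv)).
have xu : 0 < x v - x u by rewrite subr_gt0 ltx.
have xw : 0 < x v - x w by rewrite subr_gt0 ltx.
have E (t : 'I_n) : 0 < x v - x t -> ht (t, v) (mid v) =
    y v - (x v - mid v) * ((y v - y t) / (x v - x t)).
  by move=> xt; rewrite /ht /=; field; rewrite gt_eqF.
rewrite /lower !E// ltrD2l ltrN2 ltr_pM2l ?subr_gt0//.
by rewrite unit_slope ?contact_unit// ltrD2l ltrN2.
Qed.

Lemma lower_r (v u w : 'I_n) : contact v u -> contact v w ->
  (v < u)%N -> (v < w)%N -> lower v.+1 (v, u) (v, w) = (angle v u < angle v w).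
Proof.
move=> cu cw uv wv; have uv' : (u < v)%N = false by rewrite ltnNge ltnW.
have wv' : (w < v)%N = false by rewrite ltnNge ltnW.
rewrite (angle_y cu cw) ?uv' ?wv'//.
have /andP[mv _] := mid_bounds (spans_index (edge_r cu uv)).
have xu : 0 < x u - x v by rewrite subr_gt0 ltx.
have xw : 0 < x w - x v by rewrite subr_gt0 ltx.
have E (t : 'I_n) : 0 < x t - x v -> ht (v, t) (mid v.+1) =
    y v + (mid v.+1 - x v) * ((y t - y v) / (x t - x v)).
  by move=> xt; rewrite /ht /=; field; rewrite gt_eqF.
rewrite /lower !E// ltrD2l ltr_pM2l ?subr_gt0//.
by rewrite unit_slope ?contact_unit 1?contact_sym// ltrD2r.
Qed.

(** Qualifying edges that cross [v] pass below it and hence below [z], so only edges ending at [v]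
    have to be compared with [z]. *)
Lemma top_incident s (v : 'I_n) (P : pred ('I_n * 'I_n)) z : beside v s ->
  spans s z -> ht z (x v) = y v -> P z ->
  (forall e, spans s e -> P e -> ht e (x v) <= y v) ->
  (forall e, spans s e -> P e -> ht e (x v) = y v -> (e == z) || lower s e z) ->
  top s P = Some z.
Proof.
move=> sv S hz Pz Py Pi; apply: top_some => // e S' P'.
have [C|/Pi->//] := spans_crosses sv S'.
rewrite (lower_beside sv) ?orbT// hz lt_neqAle Py// andbT.
exact: crosses_neq.
Qed.

Lemma top_floor s (v : 'I_n) (P : pred ('I_n * 'I_n)) : beside v s ->
  (forall e, spans s e -> crosses v e -> P e = (ht e (x v) <= y v)) ->
  (forall e, spans s e -> ht e (x v) = y v -> ~~ P e) ->
  top s P = floor_at v s.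
Proof.
move=> sv Pc Pi; apply: eq_top => e S.
have [C|e0] := spans_crosses sv S; last by rewrite e0 ltxx (negbTE (Pi _ S e0)).
by rewrite (Pc _ S C) lt_neqAle crosses_neq.
Qed.

Lemma height_spans_l (v : 'I_n) e : spans v e -> ht e (x v) = y v ->
  exists w, [/\ e = (w, v), contact v w & (w < v)%N].
Proof. by move=> /spans_l[/crosses_neq/eqP//|]. Qed.

Lemma height_spans_r (v : 'I_n) e : spans v.+1 e -> ht e (x v) = y v ->
  exists w, [/\ e = (v, w), contact v w & (v < w)%N].
Proof. by move=> /spans_r[/crosses_neq/eqP//|]. Qed.

Lemma height_edge_l (v w : 'I_n) : contact v w -> (w < v)%N -> ht (w, v) (x v) = y v.
Proof. by move=> c /(edge_l c)/andP[/height_r]. Qed.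

Lemma height_edge_r (v w : 'I_n) : contact v w -> (v < w)%N -> ht (v, w) (x v) = y v.
Proof. by move=> _ _; rewrite height_l. Qed.

Lemma lower_cross_incident s (v : 'I_n) e z : beside v s -> spans s e ->
  spans s z -> crosses v e -> ht z (x v) = y v ->
  lower s e z = (ht e (x v) <= y v).
Proof.
move=> sv S S' C hz; apply/idP/idP => [L|le]; first by rewrite -hz (lower_at sv).
by apply: (lower_beside sv) => //; rewrite hz lt_neqAle crosses_neq.
Qed.

Lemma angle_le_eq (v t w : 'I_n) : contact v t -> contact v w ->
  angle v w <= angle v t -> (t == w) || (angle v w < angle v t).
Proof.
move=> ct cw; rewrite le_eqVlt => /orP[/eqP E|->]; last exact: orbT.
case: (eqVneq t w) => // /(angle_sep ct cw).
by rewrite E subrr normr0 ler10.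
Qed.

Lemma edge_eq_l (v t w : 'I_n) : (t == w) = ((t, v) == (w, v)).
Proof. by rewrite xpair_eqE eqxx andbT. Qed.

Lemma edge_eq_r (v t w : 'I_n) : (t == w) = ((v, t) == (v, w)).
Proof. by rewrite xpair_eqE eqxx. Qed.

Lemma lam_left (v w : 'I_n) : contact v w -> (w < v)%N ->
  (forall t, contact v t -> (t < v)%N -> angle v w <= angle v t) ->
  lam v = Some (w, v).
Proof.
move=> c wv wmin; have S := edge_l c wv; have h := height_edge_l c wv.
apply: (top_incident (beside_l v)) => //; first by rewrite h.
move=> e Se _ /(height_spans_l Se)[t [-> ct tv]].
by rewrite lower_l// -edge_eq_l angle_le_eq// wmin.
Qed.

Lemma lam_floor v : (forall t, contact v t -> ~~ (t < v)%N) ->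
  lam v = floor_at v v.
Proof.
move=> no; apply: (top_floor (beside_l v)) => // e S.
by move=> /(height_spans_l S)[t [_ ct tv]]; have := no t ct; rewrite tv.
Qed.

Lemma rho_right (v w : 'I_n) : contact v w -> (v < w)%N ->
  (forall t, contact v t -> (v < t)%N -> angle v t <= angle v w) ->
  rho v = Some (v, w).
Proof.
move=> c wv wmax; have S := edge_r c wv; have h := height_edge_r c wv.
apply: (top_incident (beside_r v)) => //; first by rewrite h.
move=> e Se _ /(height_spans_r Se)[t [-> ct tv]].
by rewrite lower_r// -edge_eq_r eq_sym angle_le_eq// wmax.
Qed.

Lemma rho_floor v : (forall t, contact v t -> ~~ (v < t)%N) ->
  rho v = floor_at v v.+1.
Proof.
move=> no; apply: (top_floor (beside_r v)) => // e S.
by move=> /(height_spans_r S)[t [_ ct tv]]; have := no t ct; rewrite tv.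
Qed.

Lemma below_left_next (v u w : 'I_n) : contact v u -> contact v w ->
  (u < v)%N -> (w < v)%N -> angle v u < angle v w ->
  (forall t, contact v t -> angle v u < angle v t -> angle v w <= angle v t) ->
  below v (Some (u, v)) = Some (w, v).
Proof.
move=> cu cw uv wv uw wmin; have S := edge_l cu uv; have S' := edge_l cw wv.
apply: (top_incident (beside_l v)) => //; [exact: height_edge_l|by rewrite /= lower_l| |].
  by move=> e Se /(lower_at (beside_l v) Se S); rewrite height_edge_l.
move=> e Se /= + /(height_spans_l Se)[t [? ct tv]]; subst e.
by rewrite !lower_l// -edge_eq_l => ut; rewrite angle_le_eq// wmin.
Qed.

Lemma below_left_last (v u : 'I_n) : contact v u -> (u < v)%N ->
  (forall t, contact v t -> (t < v)%N -> angle v t <= angle v u) ->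
  below v (Some (u, v)) = floor_at v v.
Proof.
move=> cu uv umax; have S := edge_l cu uv.
apply: (top_floor (beside_l v)) => e Se.
  by move=> C; apply: (lower_cross_incident (beside_l v)) => //; exact: height_edge_l.
move=> /(height_spans_l Se)[t [-> ct tv]] /=.
by rewrite lower_l// -leNgt umax.
Qed.

Lemma below_right_next (v u w : 'I_n) : contact v u -> contact v w ->
  (v < u)%N -> (v < w)%N -> angle v u < angle v w ->
  (forall t, contact v t -> angle v t < angle v w -> angle v t <= angle v u) ->
  below v.+1 (Some (v, w)) = Some (v, u).
Proof.
move=> cu cw uv wv uw umax; have S := edge_r cu uv; have S' := edge_r cw wv.
apply: (top_incident (beside_r v)) => //; [exact: height_edge_r|by rewrite /= lower_r| |].
  by move=> e Se /(lower_at (beside_r v) Se S'); rewrite height_edge_r.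
move=> e Se /= + /(height_spans_r Se)[t [? ct tv]]; subst e.
by rewrite !lower_r// -edge_eq_r eq_sym => tw; rewrite angle_le_eq// umax.
Qed.

Lemma below_right_last (v w : 'I_n) : contact v w -> (v < w)%N ->
  (forall t, contact v t -> (v < t)%N -> angle v w <= angle v t) ->
  below v.+1 (Some (v, w)) = floor_at v v.+1.
Proof.
move=> cw wv wmin; have S := edge_r cw wv.
apply: (top_floor (beside_r v)) => e Se.
  by move=> C; apply: (lower_cross_incident (beside_r v)) => //; exact: height_edge_r.
move=> /(height_spans_r Se)[t [-> ct tv]] /=.
by rewrite lower_r// -leNgt wmin.
Qed.

Variable Y : {set option ('I_n * 'I_n)}.
Hypothesis Y0 : None \in Y.
Hypothesis Ylr : forall v, (lam v \in Y) = (rho v \in Y).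
Hypothesis Ycard : (#|Y| <= #|[set v | lam v \in Y]|)%N.
Hypothesis deg2 : forall v, (1 < #|[set w | contact v w]|)%N.

(** Follow [e] from slab to slab: at each vertex it crosses, the cell underneath either stays the
    same or changes from [lam] to [rho], and [Y] contains both or neither. *)
Lemma below_inY s s' e : spans s e -> spans s' e ->
  (below s (Some e) \in Y) = (below s' (Some e) \in Y).
Proof.
suff H k : spans (e.2 - k) e ->
    (below (e.2 - k) (Some e) \in Y) = (below e.2 (Some e) \in Y).
  have K t : spans t e -> (below t (Some e) \in Y) = (below e.2 (Some e) \in Y).
    move=> S; have /andP[_ /andP[_ te]] := S.
    by have := H (e.2 - t)%N; rewrite subKn//; exact.
  by move=> S S'; rewrite K// K.
elim: k => [|k IH] S; first by rewrite subn0.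
have /andP[E /andP[e1 e2]] := S.
have vn : (e.2 - k.+1 < n)%N by apply: leq_ltn_trans (ltn_ord e.2); exact: leq_subr.
have k0 : (e.2 - k = (e.2 - k.+1).+1)%N by lia.
have C : crosses (Ordinal vn) e by rewrite /crosses E e1 /=; lia.
rewrite -IH; last by rewrite /spans E /=; lia.
rewrite k0; have := @below_step (Ordinal vn) (Some e) C.
by move=> [->//|[/= -> ->]]; rewrite Ylr.
Qed.

(* The face of a dart lies on its right: above the edge if the dart points left,
   below it otherwise. *)
Definition exterior_dart (d : 'I_n * 'I_n) :=
  contact d.1 d.2 &&
  (if (d.2 < d.1)%N then Some (d.2, d.1) \in Y else below d.2 (Some d) \in Y).

Definition exterior := [set d | exterior_dart d].

Lemma exterior_into_l (u v : 'I_n) : contact v u -> (u < v)%N ->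
  ((u, v) \in exterior) = (below v (Some (u, v)) \in Y).
Proof.
by move=> c uv; rewrite inE /exterior_dart /= contact_sym c ltnNge ltnW.
Qed.

Lemma exterior_into_r (u v : 'I_n) : contact v u -> (v < u)%N ->
  ((u, v) \in exterior) = (Some (v, u) \in Y).
Proof. by move=> c uv; rewrite inE /exterior_dart /= contact_sym c uv. Qed.

Lemma exterior_from_l (v w : 'I_n) : contact v w -> (w < v)%N ->
  ((v, w) \in exterior) = (Some (w, v) \in Y).
Proof. by move=> c uv; rewrite inE /exterior_dart /= c uv. Qed.

Lemma exterior_from_r (v w : 'I_n) : contact v w -> (v < w)%N ->
  ((v, w) \in exterior) = (below v.+1 (Some (v, w)) \in Y).
Proof.
move=> c vw; rewrite inE /exterior_dart /= c ltnNge ltnW//=.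
apply: below_inY; last exact: edge_r.
by rewrite /spans /isedge /= vw c leqnn.
Qed.

Lemma contact_side v w : contact v w -> (w < v)%N = false -> (v < w)%N.
Proof.
by move=> /contact_neq vw /negbT; rewrite -leqNgt leq_eqVlt (negbTE (vw : val v != val w)).
Qed.

Lemma angle_right v w : contact v w -> (v < w)%N -> 3 <= angle v w.
Proof. by move=> c vw; rewrite leNgt -angle_left// -leqNgt ltnW. Qed.

Local Notation next v u := (csucc [set t | contact v t] (angle v) u).
Local Notation wrapping v u := (wraps [set t | contact v t] (angle v) u).

(** Both darts border the sector swept by turning from [u] to its successor. A sector containing the
    downward direction is [floor_at] on either side of [v]; one containing the upward direction is
    [lam] on the left and [rho] on the right, which [Ylr] identifies. *)
Lemma exterior_rotate (v u : 'I_n) : contact v u ->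
  ((u, v) \in exterior) = ((v, next v u) \in exterior) /\
  (wrapping v u -> ((u, v) \in exterior) = (rho v \in Y)).
Proof.
move=> cu; have uN : u \in [set t | contact v t] by rewrite inE.
case: (csuccP (angle v) uN) => w; rewrite inE => cw.
  move=> uw wmin; split=> //.
  have {}wmin t : contact v t -> angle v u < angle v t -> angle v w <= angle v t.
    by move=> ct; apply: wmin; rewrite inE.
  have [wv|/negbTE/(contact_side cw) vw] := boolP (w < v)%N.
    have uv : (u < v)%N by rewrite angle_left//; apply: lt_trans uw _; rewrite -angle_left.
    by rewrite exterior_into_l// exterior_from_l// (@below_left_next v u w).
  have umax t : contact v t -> angle v t < angle v w -> angle v t <= angle v u.
    by move=> ct tw; rewrite leNgt; apply/negP => /(wmin _ ct); rewrite leNgt tw.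
  (* From the last contact on the left to the first one on the right: the sector passes below
     [v]. *)
  have [uv|/negbTE/(contact_side cu) vu] := boolP (u < v)%N.
    rewrite exterior_into_l// exterior_from_r// below_left_last//; last first.
      move=> t ct tv; apply: umax => //.
      by apply: lt_le_trans (angle_right cw vw); rewrite -angle_left.
    rewrite below_right_last ?floor_at_lr// => t ct vt; apply: wmin => //.
    by apply: lt_le_trans (angle_right ct vt); rewrite -angle_left.
  by rewrite exterior_into_r// exterior_from_r// (@below_right_next v u w).
move=> umax wmin.
have {}umax t : contact v t -> angle v t <= angle v u by move=> ct; apply: umax; rewrite inE.
have {}wmin t : contact v t -> angle v w <= angle v t by move=> ct; apply: wmin; rewrite inE.
have [uv|/negbTE/(contact_side cu) vu] := boolP (u < v)%N.
  (* All contacts lie on the left, so the wrapping sector contains the whole right side and the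
     cells just below and just above [v] agree there. *)
  have wv : (w < v)%N.
    by rewrite angle_left//; apply: le_lt_trans (umax _ cw) _; rewrite -angle_left.
  have nor t : contact v t -> ~~ (v < t)%N.
    move=> ct; apply/negP => vt; have := umax _ ct; rewrite leNgt => /negP[].
    by apply: lt_le_trans (angle_right ct vt); rewrite -angle_left.
  rewrite exterior_into_l// exterior_from_l// -(@lam_left v w)//; last first.
    by move=> t ct _; exact: wmin.
  rewrite Ylr below_left_last//; last by move=> t ct _; exact: umax.
  by rewrite floor_at_lr -rho_floor.
rewrite exterior_into_r// -(@rho_right v u)//; last by move=> t ct _; exact: umax.
split=> //; rewrite -Ylr.
have [wv|/negbTE/(contact_side cw) vw] := boolP (w < v)%N.
  by rewrite exterior_from_l// (@lam_left v w)// => t ct _; exact: wmin.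
rewrite exterior_from_r// below_right_last//; last by move=> t ct _; exact: wmin.
rewrite -floor_at_lr lam_floor// => t ct; apply/negP => tv.
have := wmin _ ct; rewrite leNgt => /negP[].
by apply: lt_le_trans (angle_right cw vw); rewrite -angle_left.
Qed.

Local Notation left := (fun v w : 'I_n => (w < v)%N).

(** A left-pointing exterior dart is determined by its edge, which names a cell of [Y]; the cell
    [None] is left over and makes the inequality strict. *)
Lemma left_exterior : (#|[set d in exterior | left d.1 d.2]| < #|Y|)%N.
Proof.
pose f (d : 'I_n * 'I_n) := Some (d.2, d.1).
have finj : injective f by move=> [a b] [c d]; rewrite /f /= => -[-> ->].
rewrite -(card_imset _ finj).
rewrite (cardsD1 None Y) Y0 add1n ltnS; apply/subset_leq_card/fintype.subsetP => z.
by case/imsetP => d; rewrite !inE => /andP[/andP[_ +] dl] ->; rewrite dl.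
Qed.

(** At each vertex the contact of largest angle wraps, and its dart is exterior as soon as the space
    just above the vertex belongs to [Y]. *)
Lemma wraps_exterior :
  (#|[set v | lam v \in Y]| <= #|[set d in exterior | dart_wraps contact angle d]|)%N.
Proof.
pose f (d : 'I_n * 'I_n) := d.2.
apply: leq_trans (leq_imset_card f _); apply/subset_leq_card/fintype.subsetP => v.
rewrite inE Ylr => rY.
have /card_gt0P[u0 u0N] : (0 < #|[set w | contact v w]|)%N by exact: ltnW (deg2 v).
case: (@arg_maxP _ _ _ u0 (fun u => u \in [set t | contact v t]) (angle v) u0N) => u uN umax.
have cu : contact v u by move: uN; rewrite inE.
have W : wrapping v u by rewrite wraps_max//; apply/forall_inP => c; exact: umax.
apply/imsetP; exists (u, v) => //.
by rewrite inE /dart_wraps /= /nbrs W andbT; have [_ ->] := exterior_rotate cu.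
Qed.

Lemma contact_layer : exists B : {set 'I_n},
  [/\ (0 < #|B|)%N,
    (#|[set d : 'I_n * 'I_n | contact d.1 d.2]| + 2 * #|B| + 6 <= 6 * n)%N &
    (#|[set d : 'I_n * 'I_n | contact d.1 d.2]| + 12 <=
      #|[set d : 'I_n * 'I_n | [&& contact d.1 d.2, d.1 \notin B & d.2 \notin B]]| +
      6 * #|B|)%N].
Proof.
have XD : exterior \subset darts contact.
  by apply/fintype.subsetP => d; rewrite !inE => /andP[].
have [|||B [B0 B1 B2]] := @boundary_layer R 'I_n contact angle left contact_sym
  _ angle_rev angle_sep deg2 exterior XD.
- by move=> u v /contact_neq uv; rewrite -leqNgt [LHS]ltn_neqAle (uv : val u != val v).
- move=> d dX; have := fintype.subsetP XD _ dX; rewrite inE contact_sym => c.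
  by have [<- _] := exterior_rotate c; rewrite -surjective_pairing.
- exact: leq_trans left_exterior (leq_trans Ycard wraps_exterior).
exists B; split=> //; first by move: B1; rewrite card_ord.
suff <- : [set d in darts contact | (d.1 \notin B) && (d.2 \notin B)] =
  [set d | [&& contact d.1 d.2, d.1 \notin B & d.2 \notin B]] by [].
by apply/setP => d; rewrite !inE.
Qed.

End Penny.

(** * Harborth's bound *)

Section Direction.
Variable R : realType.
Implicit Types a b c d : R.
Local Notation pi := (@trigo.pi R).

Lemma cos_third_pi : cos (pi / 3) = 2^-1 :> R.
Proof.
have p0 := pi_gt0 R.
have E : cos (pi / 3 *+ 2) = - cos (pi / 3) :> R.
  rewrite -[in RHS](cosN (pi / 3)) -cosDpi; congr cos.
  by field.
have c0 : 0 < cos (pi / 3) :> R by apply: cos_gt0_pihalf; apply/andP; split; lra.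
move: E; rewrite cos_mulr2n => E.
(* Factorization of [2 c^2 - 1 = - c]; positivity of the cosine discards the root [-1]. *)
have : (cos (pi / 3) - 2^-1) * (cos (pi / 3) + 1) = 0 :> R by nra.
move/eqP; rewrite mulf_eq0 subr_eq0 => /orP[/eqP//|]; rewrite gt_eqF//.
by rewrite addr_gt0.
Qed.

(* Counterclockwise angle from the upward direction, in units of pi / 3. *)
Definition direction a b : R :=
  3 / pi * (if a < 0 then acos b else pi + acos (- b)).

Lemma unit_bounds a b : a ^+ 2 + b ^+ 2 = 1 -> -1 <= b <= 1.
Proof. by move=> ab; apply/andP; split; have := sqr_ge0 a; nra. Qed.

Lemma unit_strict a b : a != 0 -> a ^+ 2 + b ^+ 2 = 1 -> -1 < b < 1.
Proof.
move=> a0 ab; have := unit_bounds ab; have : a ^+ 2 != 0 by rewrite sqrf_eq0.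
rewrite !lt_neqAle => a20 /andP[-> ->]; rewrite !andbT; apply/andP; split.
  by apply: contraNneq a20 => b1; rewrite -(addrK (b ^+ 2) (a ^+ 2)) ab -b1; lra.
by apply: contraNneq a20 => b1; rewrite -(addrK (b ^+ 2) (a ^+ 2)) ab b1; lra.
Qed.

Let s3 : 0 < 3 / pi :> R. Proof. by rewrite divr_gt0// pi_gt0. Qed.

Let s3pi : 3 / pi * pi = 3 :> R. Proof. by rewrite divfK// gt_eqF// pi_gt0. Qed.

Lemma direction_lt3 a b : a != 0 -> a ^+ 2 + b ^+ 2 = 1 ->
  (direction a b < 3) = (a < 0).
Proof.
move=> a0 ab; have /andP[b1 b2] := unit_strict a0 ab.
rewrite /direction -{2}s3pi ltr_pM2l//; case: ifP => _.
  by rewrite acos_ltpi// b1 ltW.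
by rewrite ltNge lerDl acos_ge0// lerNl opprK lerNl !ltW.
Qed.

Lemma direction_opp a b : a < 0 -> direction (- a) (- b) = direction a b + 3.
Proof.
move=> a0; rewrite /direction a0 oppr_lt0 ltNge (ltW a0) /= opprK mulrDr s3pi.
exact: addrC.
Qed.

(** Since the angle is measured from the upward direction, the vector is [(- sin t, cos t)]. *)
Lemma direction_cos_sin a b : a != 0 -> a ^+ 2 + b ^+ 2 = 1 ->
  exists2 t, 0 <= t < pi *+ 2 &
    [/\ direction a b = 3 / pi * t, cos t = b & sin t = - a].
Proof.
move=> a0 ab; have /andP[b1 b2] := unit_strict a0 ab.
have bb := unit_bounds ab; have nbb : -1 <= - b <= 1 by rewrite lerNl opprK lerNl andbC.
have a2 : 1 - b ^+ 2 = a ^+ 2 by rewrite -ab addrK.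
rewrite /direction; case: (ltP a 0) => ha.
  exists (acos b).
    rewrite acos_ge0//=; apply: lt_le_trans (acos_ltpi _) _; first by rewrite b1 ltW.
    by rewrite mulr2n lerDl pi_ge0.
  split=> //; first by rewrite acosK.
  by rewrite sin_acos// a2 sqrtr_sqr ltr0_norm.
exists (pi + acos (- b)).
  rewrite addr_ge0 ?pi_ge0 ?acos_ge0//= mulr2n ltrD2l acos_ltpi//.
  by rewrite ltrNr opprK b2 lerNl ltW.
rewrite addrC; split=> //; first by rewrite cosDpi acosK ?opprK.
by rewrite sinDpi sin_acos// sqrrN a2 sqrtr_sqr ger0_norm.
Qed.

Lemma direction_sep a b c d : a != 0 -> c != 0 ->
  a ^+ 2 + b ^+ 2 = 1 -> c ^+ 2 + d ^+ 2 = 1 ->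
  1 <= (a - c) ^+ 2 + (b - d) ^+ 2 ->
  1 <= `|direction a b - direction c d| <= 5.
Proof.
move=> a0 c0 ab cd; have p0 := pi_gt0 R.
have [t /andP[t0 t1] [-> ct st]] := direction_cos_sin a0 ab.
have [u /andP[u0 u1] [-> cu su]] := direction_cos_sin c0 cd => far.
(* The squared chord between two unit vectors is [2 - 2 cos (t - u)]. *)
have {}far : cos `|t - u| <= 2^-1.
  have -> : cos `|t - u| = cos (t - u) by case: (ger0P (t - u)) => _ //; rewrite cosN.
  by rewrite cosB ct cu st su mulrNN; lra.
rewrite -mulrBr normrM (gtr0_norm s3).
have : `|t - u| < pi *+ 2 by rewrite ltr_norml; apply/andP; split; lra.
move: (normr_ge0 (t - u)) far; set w := `|t - u| => w0 far w1.
have third : 0 <= pi / 3 <= pi by apply/andP; split; lra.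
have key z : 0 <= z <= pi -> cos z <= 2^-1 -> pi / 3 <= z.
  move=> zpi; rewrite -cos_third_pi leNgt (leNgt _ z); apply: contra => h.
  by rewrite ltr_cos// in_itv /=.
have low : pi / 3 <= w.
  by have [wp|wp] := leP w pi; [apply: key => //; rewrite w0|lra].
have high : w <= 5 * (pi / 3).
  have [wp|wp] := leP w pi; first by lra.
  have : pi / 3 <= pi *+ 2 - w.
    apply: key; first by apply/andP; split; lra.
    by rewrite -cosN opprB -(cosD2pi (w - pi *+ 2)) subrK.
  lra.
have E1 : 1 = 3 / pi * (pi / 3) by rewrite mulrA s3pi divff ?pnatr_eq0.
have -> : 5 = 3 / pi * (5 * (pi / 3)) by rewrite mulrCA -E1 mulr1.
by rewrite {1}E1 !ler_pM2l// low.
Qed.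

Lemma direction_mono a b c d : a != 0 -> c != 0 ->
  a ^+ 2 + b ^+ 2 = 1 -> c ^+ 2 + d ^+ 2 = 1 -> (a < 0) = (c < 0) ->
  (direction a b < direction c d) = (if a < 0 then d < b else b < d).
Proof.
move=> a0 c0 ab cd ac; have bb := unit_bounds ab; have dd := unit_bounds cd.
have acosE p q : -1 <= p <= 1 -> -1 <= q <= 1 -> (acos p < acos q) = (q < p).
  move=> hp hq; rewrite -[in RHS](acosK hp) -[in RHS](acosK hq) ltr_cos//;
    by rewrite in_itv /= acos_ge0// acos_lepi.
rewrite /direction -ac ltr_pM2l//; case: ifP => _; first by rewrite acosE.
by rewrite ltrD2l acosE ?ltrN2// lerNl opprK lerNl andbC.
Qed.

End Direction.

(** * Induction on the number of points *)

Section Harborth.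
Variables (R : realType) (V : finType).
Implicit Types (px py : V -> R) (A B : {set V}).

Definition sqdist px py u v : R := (px u - px v) ^+ 2 + (py u - py v) ^+ 2.

Definition touching px py A :=
  [set d : V * V | [&& sqdist px py d.1 d.2 == 1, d.1 \in A & d.2 \in A]].

Lemma sqdistC px py u v : sqdist px py u v = sqdist px py v u.
Proof.
by rewrite /sqdist -[px u - px v]opprB -[py u - py v]opprB !sqrrN.
Qed.

Section DistinctAbscissas.
Variables px py : V -> R.
Hypothesis pxinj : injective px.
Hypothesis penny : forall u v, u != v -> 1 <= sqdist px py u v.

Local Notation touch u v := (sqdist px py u v == 1).
Local Notation touching := (touching px py).

(** Relabelling [A] by increasing abscissa makes the sweep applicable; the layer is then transported
    back along [f]. *)
Lemma touching_layer A : (0 < #|A|)%N ->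
  (forall v, v \in A -> (1 < #|[set w in A | touch v w]|)%N) ->
  exists B, [/\ B \subset A, (0 < #|B|)%N,
    (#|touching A| + 2 * #|B| + 6 <= 6 * #|A|)%N &
    (#|touching A| + 12 <= #|touching (A :\: B)| + 6 * #|B|)%N].
Proof.
move=> /card_gt0P[v0 v0A] deg.
pose s := sort (fun u v => px u <= px v) (enum A).
have s_size : size s = #|A| by rewrite size_sort cardE.
have s_uniq : uniq s by rewrite sort_uniq enum_uniq.
have s_mem v : (v \in s) = (v \in A) by rewrite mem_sort mem_enum.
have s_sorted : sorted (fun u v => px u < px v) s.
  have -> : sorted (fun u v => px u < px v) s = sorted <%R (map px s).
    by rewrite sorted_map.
  rewrite lt_sorted_uniq_le map_inj_uniq// s_uniq /= sorted_map.
  by apply: sort_sorted => u v; exact: le_total.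
set n := #|A| in s_size *.
pose f (i : 'I_n) := nth v0 s i.
pose x i := px (nth v0 s i); pose y i := py (nth v0 s i).
have fA i : f i \in A by rewrite -s_mem mem_nth// s_size.
have finj : injective f.
  by move=> i j /eqP; rewrite nth_uniq ?s_size// => /eqP/val_inj.
have fsurj v : v \in A -> exists i, v = f i.
  rewrite -s_mem => vs; have vn : (index v s < n)%N by rewrite -s_size index_mem.
  by exists (Ordinal vn); rewrite /f /= nth_index.
have xinc i j : (i < j < n)%N -> x i < x j.
  move=> /andP[ij jn]; apply: (sorted_ltn_nth _ v0 s_sorted) => //.
  - by move=> a b c; exact: lt_trans.
  - by rewrite inE s_size (ltn_trans ij).
  - by rewrite inE s_size.
have pen (i j : 'I_n) : i != j -> 1 <= dist2 x y i j.
  by move=> ij; apply: penny; rewrite (inj_eq finj).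
have n0 : (0 < n)%N by apply/card_gt0P; exists v0.
have imE (P : pred (V * V)) (Q : pred ('I_n * 'I_n)) :
    (forall i j, Q (i, j) = P (f i, f j)) ->
    (forall u v, P (u, v) -> u \in A /\ v \in A) ->
    #|[set d | Q d]| = #|[set d | P d]|.
  move=> QP PA; pose g (d : 'I_n * 'I_n) := (f d.1, f d.2).
  have ginj : injective g by move=> [a b] [c d]; rewrite /g /= => -[/finj-> /finj->].
  rewrite -(card_imset _ ginj); apply: eq_card => -[u v]; rewrite inE.
  apply/imsetP/idP => [[[i j]]|Puv]; first by rewrite inE QP => + [-> ->].
  have [/fsurj[i ui] /fsurj[j vj]] := PA _ _ Puv.
  exists (i, j); first by rewrite inE QP -ui -vj.
  by rewrite /g ui vj.
have degI (i : 'I_n) : (1 < #|[set j | contact x y i j]|)%N.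
  have := deg _ (fA i); rewrite -(card_imset (mem [set j | contact x y i j]) finj).
  suff -> : [set w in A | touch (f i) w] = f @: [set j | contact x y i j] by [].
  apply/setP => w; rewrite inE; apply/andP/imsetP => [[/fsurj[j ->] t]|[j]].
    by exists j; rewrite ?inE.
  by rewrite inE => t ->.
pose angle (i j : 'I_n) := direction (x j - x i) (y j - y i).
have ne0 (v w : 'I_n) : contact x y v w -> x w - x v != 0.
  move=> /contact_neq vw; rewrite subr_eq0 /x (inj_eq pxinj).
  by rewrite -[nth _ _ w]/(f w) -[nth _ _ v]/(f v) (inj_eq finj) eq_sym.
have unit (v w : 'I_n) : contact x y v w -> (x w - x v) ^+ 2 + (y w - y v) ^+ 2 = 1.
  by rewrite contact_sym => /eqP.
have [Y [Y0 Ylr Yc]] := exterior_cells xinc pen n0.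
have [||||B [B0 B1 B2]] := @contact_layer R n x y xinc pen n0 angle _ _ _ _ Y Y0 Ylr Yc degI.
- move=> v w c; rewrite /angle direction_lt3 ?ne0 ?unit// subr_lt0.
  by rewrite (ltx xinc).
- move=> v w c wv; rewrite /angle -direction_opp ?opprB//.
  by rewrite subr_lt0 (ltx xinc).
- move=> u v w cv cw vw; rewrite /angle direction_sep ?ne0 ?unit//.
  have := pen _ _ vw; rewrite /dist2; congr (_ <= _); ring.
- move=> v u w cu cw uw; rewrite /angle direction_mono ?ne0 ?unit//.
    by rewrite subr_lt0 (ltx xinc) !ltrD2r.
  by rewrite !subr_lt0 !(ltx xinc).
have BA : f @: B \subset A by apply/fintype.subsetP => _ /imsetP[i _ ->].
have cB : #|f @: B| = #|B| by rewrite card_imset.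
exists (f @: B); rewrite BA cB; split=> //.
  move: B1; congr (_ + _ + _ <= _)%N; apply: imE => [i j|u v /and3P[]//].
  by rewrite !fA !andbT.
move: B2; congr (_ + _ <= _ + _)%N; apply: imE => /=.
- by move=> i j; rewrite !fA !andbT.
- by move=> u v /and3P[].
- by move=> i j; rewrite !inE !(mem_imset _ _ finj) !fA !andbT.
- by move=> u v; rewrite !inE => /and3P[_ /andP[_ ->] /andP[_ ->]].
Qed.

Lemma touching_remove A v : v \in A ->
  (#|[set w in A | touch v w]| <= 1)%N ->
  (#|touching A| <= #|touching (A :\ v)| + 2)%N.
Proof.
move=> vA deg.
pose N := [set w in A | touch v w].
have sub : touching A \subset touching (A :\ v) :|:
    ([set (v, w) | w in N] :|: [set (w, v) | w in N]).
  apply/fintype.subsetP => -[a b]; rewrite inE /= => /and3P[t aA bA].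
  rewrite !finset.in_setU; have [av|av] := eqVneq a v.
    by rewrite av imset_f ?orbT// inE bA -av.
  have [bv|bv] := eqVneq b v.
    by rewrite bv [X in _ || (_ || X)]imset_f ?orbT// inE aA -bv sqdistC.
  by rewrite !inE /= t aA bA av bv.
have := subset_leq_card sub.
have [+ _] := leq_card_setU (touching (A :\ v))
  ([set (v, w) | w in N] :|: [set (w, v) | w in N]).
have [+ _] := leq_card_setU [set (v, w) | w in N] [set (w, v) | w in N].
have l1 : (#|[set (v, w) | w in N]| <= #|N|)%N by exact: leq_imset_card.
have l2 : (#|[set (w, v) | w in N]| <= #|N|)%N by exact: leq_imset_card.
by rewrite -/N in deg; move: deg l1 l2; lia.
Qed.

(** Remove either a vertex with at most one contact or a whole boundary layer. The first conjunct
    keeps the natural subtraction exact. *)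
Lemma harborth_distinct A : (#|touching A| <= 6 * #|A|)%N /\
  (48 * #|A| <= (6 * #|A| - #|touching A|) ^ 2 + 12)%N.
Proof.
have [k] := ubnP #|A|; elim: k A => // k IH A; rewrite ltnS => Ak.
have [A0|A0] := posnP #|A|.
  have -> : touching A = finset.set0.
    apply/setP => d; rewrite !inE; apply/negP => /and3P[_ dA _].
    by move: A0 => /card0_eq/(_ d.1); rewrite dA.
  by rewrite A0 cards0.
have [/exists_inP[v vA deg]|/exists_inPn deg] :=
  boolP [exists v in A, #|[set w in A | touch v w]| <= 1]%N.
  have := touching_remove vA deg; have cA : #|A| = #|A :\ v|.+1 by rewrite (cardsD1 v A) vA.
  have [] := IH (A :\ v); first by rewrite -ltnS -cA.
  have [n0|n0] := posnP #|A :\ v|.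
    move=> _ _; have -> : touching A = finset.set0.
      apply/setP => d; rewrite !inE; apply/negP => /and3P[+ d1 d2].
      have eqv u : u \in A -> u = v.
        move=> uA; apply/eqP/negPn/negP => uv.
        by move: n0 => /card0_eq/(_ u); rewrite !inE uv uA.
      by rewrite (eqv _ d1) (eqv _ d2) /sqdist !subrr expr0n addr0 eq_sym oner_eq0.
    by rewrite cA n0 cards0.
  move: n0; rewrite cA; set n := #|_ :\ v|; set a := #|touching A|; set b := #|touching _|.
  move=> n0 b1 b2 ab; split; first lia.
  (* With [s = 6 n - b >= 6], passing to [s + 4] adds [8 s + 16 >= 64] to the square, more than the
     required 48. *)
  have w6 : (6 <= 6 * n - b)%N by rewrite -leq_sqr; lia.
  have : ((6 * n - b + 4) ^ 2 <= (6 * n.+1 - a) ^ 2)%N by rewrite leq_sqr; lia.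
  by rewrite sqrnD; lia.
have [|B [BA B0 B1 B2]] := touching_layer A0.
  by move=> v /deg; rewrite -ltnNge.
have cA : #|A| = (#|A :\: B| + #|B|)%N by rewrite addnC cardsDS// subnKC ?subset_leq_card.
have [] := IH (A :\: B); first by move: Ak; rewrite cA; lia.
move: B1 B2 B0; rewrite cA.
set n := #|A :\: B|; set b := #|B|; set a := #|touching A|; set c := #|touching _|.
move=> B1 B2 B0 c1 c2; split; first lia.
(* [B2] gives [6 n - c <= t] and [B1] gives [2 b <= t + 6], so [24 t + 144 >= 48 b]: the square
   grows by as much as the layer requires. *)
pose t := (6 * (n + b) - a - 12)%N.
have -> : (6 * (n + b) - a = t + 12)%N by rewrite /t; lia.
have : ((6 * n - c) ^ 2 <= t ^ 2)%N by rewrite leq_sqr /t; lia.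
by rewrite sqrnD /t; lia.
Qed.
End DistinctAbscissas.

(** The sweep needs distinct abscissas; two given points share one only at the roots of a nonzero
    polynomial in the rotation parameter. *)
Lemma generic_rotation px py :
  (forall u v, u != v -> (px u != px v) || (py u != py v)) ->
  exists c s : R, c ^+ 2 + s ^+ 2 = 1 /\
    injective (fun v => c * px v + s * py v).
Proof.
move=> pinj.
(* c = (1 - t^2)/(1 + t^2), s = 2t/(1 + t^2) for t off a finite set of roots *)
pose q (d : V * V) : {poly R} :=
  (px d.1 - px d.2) *: (1 - 'X^2) + ((py d.1 - py d.2) * 2) *: 'X.
pose Q := \prod_(d : V * V | d.1 != d.2) q d.
have Q0 : Q != 0.
  apply/prodf_neq0 => d /pinj pd.
  apply/eqP => /polyP q0; have := q0 0%N; have := q0 1%N.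
  rewrite /q !(coefE, coefZ, coefD, coefB, coef1, coefXn, coefX, coef0) /=.
  rewrite !subr0 !mulr1 !mulr0 !add0r !addr0 => /eqP; rewrite mulf_eq0 pnatr_eq0 orbF.
  by rewrite subr_eq0 => /eqP h2 /eqP; rewrite subr_eq0 => /eqP h1; rewrite h1 h2 !eqxx in pd.
have [t Qt] : exists t, Q.[t] != 0.
  pose r := [seq (i%:R : R) | i <- iota 0 (size Q)].
  have /allPn[t _ ht] : ~~ all (root Q) r; last by exists t.
  apply/negP => rQ; have := max_poly_roots Q0 rQ.
  rewrite map_inj_uniq ?iota_uniq; last by move=> i j /eqP; rewrite eqr_nat => /eqP.
  by rewrite size_map size_iota ltnn => /(_ isT).
have t1 : 1 + t ^+ 2 != 0 by rewrite gt_eqF// ltr_pwDl// sqr_ge0.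
exists ((1 - t ^+ 2) / (1 + t ^+ 2)), (2 * t / (1 + t ^+ 2)); split; first by field.
move=> u v E; apply/eqP/negPn/negP => uv.
move: Qt; rewrite horner_prod => /prodf_neq0/(_ (u, v) uv)/negP[].
rewrite /q !hornerE /=; apply/eqP.
have : (px u - px v) * (1 - t ^+ 2) + (py u - py v) * 2 * t =
  (1 + t ^+ 2) * ((1 - t ^+ 2) / (1 + t ^+ 2) * px u + 2 * t / (1 + t ^+ 2) * py u -
  ((1 - t ^+ 2) / (1 + t ^+ 2) * px v + 2 * t / (1 + t ^+ 2) * py v)) by field.
by rewrite E subrr mulr0.
Qed.

Theorem harborth px py : (forall u v, u != v -> 1 <= sqdist px py u v) ->
  let D := #|[set d : V * V | sqdist px py d.1 d.2 == 1]| in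
  (D <= 6 * #|V|)%N /\ (48 * #|V| <= (6 * #|V| - D) ^ 2 + 12)%N.
Proof.
move=> penny.
have [|c [s [cs qinj]]] := generic_rotation (px := px) (py := py).
  move=> u v /penny; apply: contraTT; rewrite negb_or !negbK => /andP[/eqP h1 /eqP h2].
  by rewrite /sqdist h1 h2 !subrr expr0n addr0 ler10.
have E u v : sqdist (fun v => c * px v + s * py v) (fun v => c * py v - s * px v) u v =
    sqdist px py u v.
  by rewrite -[RHS]mul1r -cs /sqdist; ring.
have := harborth_distinct qinj (py := fun v => c * py v - s * px v) _ [set: V].
rewrite cardsT; have -> : touching (fun v => c * px v + s * py v)
    (fun v => c * py v - s * px v) [set: V] = [set d | sqdist px py d.1 d.2 == 1].
  by apply/setP => d; rewrite !inE E !andbT.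
by apply=> u v /penny; rewrite E.
Qed.

End Harborth.

(** * Ground states *)

Section Energy.
Variable R : realType.
Implicit Types (u v : 'cV[R]_2).

Definition plane_sqdist u v : R := (u 0 0 - v 0 0) ^+ 2 + (u 1 0 - v 1 0) ^+ 2.

Lemma enorm_sub u v : enorm (u - v) = Num.sqrt (plane_sqdist u v).
Proof.
rewrite /enorm big_ord_recl big_ord1 !mxE; congr (Num.sqrt (_ + _ ^+ 2)).
by congr (u _ _ - v _ _); apply: val_inj.
Qed.

Lemma plane_sqdist_ge0 u v : 0 <= plane_sqdist u v.
Proof. by rewrite addr_ge0// sqr_ge0. Qed.

Lemma enorm_sub_lt1 u v : (enorm (u - v) < 1) = (plane_sqdist u v < 1).
Proof.
by rewrite enorm_sub -[in LHS]sqrtr1 ltr_sqrt// ltr01.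
Qed.

Lemma enorm_sub_eq1 u v : (enorm (u - v) == 1) = (plane_sqdist u v == 1).
Proof.
by rewrite enorm_sub -[in LHS]sqrtr1 eqr_sqrt// plane_sqdist_ge0.
Qed.

Variable N : nat.
Implicit Types x y : 'I_N -> 'cV[R]_2.

Definition contacts x := [set d : 'I_N * 'I_N | plane_sqdist (x d.1) (x d.2) == 1].

Lemma contacts_even x : ~~ odd #|contacts x|.
Proof.
pose L := [set d in contacts x | (d.1 < d.2)%N].
pose G := [set d in contacts x | (d.2 < d.1)%N].
have LG : #|L| = #|G|.
  have sinj : injective (fun d : 'I_N * 'I_N => (d.2, d.1)) by move=> [a b] [c d] /= [-> ->].
  rewrite -(card_imset L sinj); apply: eq_card => -[a b]; apply/imsetP/idP.
    move=> [[c d]]; rewrite !inE /= => /andP[c1 c2] [-> ->].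
    by rewrite c2 andbT /plane_sqdist -[_ - _]opprB sqrrN -[x d 1 0 - _]opprB sqrrN.
  rewrite !inE /= => /andP[c1 c2]; exists (b, a) => //.
  by rewrite !inE /= c2 andbT /plane_sqdist -[_ - _]opprB sqrrN -[x b 1 0 - _]opprB sqrrN.
have -> : contacts x = L :|: G.
  apply/setP => -[a b]; rewrite !inE /= -andb_orr -neq_ltn.
  case: (eqVneq a b) => [->|ab]; last by rewrite -val_eqE/= in ab; rewrite ab andbT.
  by rewrite eqxx andbF /plane_sqdist !subrr expr0n addr0 eq_sym oner_eq0.
rewrite cardsU LG (_ : L :&: G = finset.set0) ?cards0 ?subn0 ?addnn ?odd_double//.
apply/setP => d; rewrite !inE; apply/negP => /andP[/andP[_ h] /andP[_]].
by rewrite ltnNge ltnW.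
Qed.

Lemma energy_close x i j : i != j -> plane_sqdist (x i) (x j) < 1 ->
  energy x = +oo%E.
Proof.
move=> ij xij.
have V0 (a : R) : V_HR a != -oo%E by rewrite /V_HR; case: ifP => //; case: ifP.
apply/eqP; rewrite /energy esum_eqy; last first.
  move=> a _; rewrite esum_eqNy; apply/existsP => -[b /andP[_ h]].
  by have /negP := V0 (enorm (x a - x b)).
apply/existsP; exists i; rewrite /= esum_eqy; last by move=> b _; exact: V0.
apply/existsP; exists j; apply/andP; split; first exact: ij.
by rewrite /V_HR enorm_sub_lt1 xij /=.
Qed.

Lemma energy_apart x :
  (forall i j, i != j -> 1 <= plane_sqdist (x i) (x j)) ->
  energy x = (- #|contacts x|%:R)%:E.
Proof.
move=> far.
have E i j : i != j -> V_HR (enorm (x i - x j)) =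
    (- (plane_sqdist (x i) (x j) == 1)%:R)%:E.
  move=> /far; rewrite /V_HR enorm_sub_lt1 enorm_sub_eq1 leNgt => /negbTE ->.
  by case: eqP => _; rewrite ?mulr0n ?oppr0 ?mulr1n.
rewrite /energy; under eq_bigr do under eq_bigr => j ij do rewrite E//.
under eq_bigr do rewrite sumEFin.
rewrite sumEFin; congr EFin.
rewrite -sum1_card natr_sum -sumrN.
rewrite (eq_bigr (fun i =>
  - \sum_(j | i != j) (plane_sqdist (x i) (x j) == 1)%:R)); last first.
  by move=> i _; rewrite sumrN.
rewrite !sumrN; congr (- _).
rewrite pair_big_dep /= big_mkcond [RHS]big_mkcond; apply: eq_bigr => -[i j] _ /=.
rewrite inE /=; case: (eqVneq i j) => [->|_] /=; last by case: ifP.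
by rewrite /plane_sqdist !subrr expr0n addr0 eq_sym oner_eq0.
Qed.

(* Harborth's bound alone allows 6 N - D = 12 k + 5, excluded by parity. *)
Lemma contacts_bound x k : N = (3 * k ^ 2 + 2 * k + 1)%N ->
  (forall i j, i != j -> 1 <= plane_sqdist (x i) (x j)) ->
  (#|contacts x| + 12 * k + 6 <= 6 * N)%N.
Proof.
move=> NE far; have := harborth (px := fun i => x i 0 0) (py := fun i => x i 1 0) far.
rewrite /= -[[set d | _]]/(contacts x) card_ord => -[D1 D2].
have := contacts_even x; move: D1 D2; set D := #|contacts x|.
move=> D1 D2 even.
have : ((12 * k + 4) ^ 2 < (6 * N - D) ^ 2)%N by rewrite sqrnD NE in D2 *; lia.
rewrite ltn_sqr => w.
have : (6 * N - D != 12 * k + 5)%N.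
  apply: contraNneq even => h; have -> : D = (6 * N - (12 * k + 5))%N by lia.
  by lia.
lia.
Qed.

Lemma ground_state_image x k : N = (3 * k ^ 2 + 2 * k + 1)%N ->
  (forall i j, i != j -> 1 <= plane_sqdist (x i) (x j)) ->
  (6 * N <= #|contacts x| + 12 * k + 6)%N ->
  ground_state N [fset x i | i : 'I_N]%fset.
Proof.
move=> NE far xN.
have xinj : injective x.
  move=> i j xij; apply/eqP/negPn/negP => /far.
  by rewrite xij /plane_sqdist !subrr expr0n addr0 ler10.
split; first by rewrite card_imfset//= -cardE card_ord.
exists x; split=> // y; rewrite (energy_apart far).
have [/forallP ypen|] := boolP [forall i, forall j, (i != j) ==> (1 <= plane_sqdist (y i) (y j))].
  have yfar i j : i != j -> 1 <= plane_sqdist (y i) (y j).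
    by move=> ij; have /forallP/(_ j) := ypen i; rewrite ij.
  rewrite (energy_apart yfar) lee_fin lerN2 ler_nat.
  have := contacts_bound NE yfar; lia.
rewrite negb_forall => /existsP[i]; rewrite negb_forall => /existsP[j].
rewrite negb_imply -ltNge => /andP[ij yij].
by rewrite (energy_close ij yij) leey.
Qed.

End Energy.

(** * Contacts of lattice configurations *)

(** On each line only the point of largest [key] may fail to start a step inside [A]. *)
Lemma card_le_steps (T F : finType) (A : {set T}) (step : rel T) (line : T -> F)
    (key : T -> nat) :
  (forall p q, p \in A -> q \in A -> line p = line q -> (key p < key q)%N ->
    exists2 s, s \in A & step p s) ->
  (forall p q, p \in A -> q \in A -> line p = line q -> key p = key q -> p = q) ->
  (#|A| <= #|[set d : T * T | [&& step d.1 d.2, d.1 \in A & d.2 \in A]]| + #|F|)%N.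
Proof.
move=> next inj; set E := [set d | _].
pose B := [set d.1 | d in E].
have BA : B \subset A by apply/fintype.subsetP => _ /imsetP[d + ->]; rewrite inE => /and3P[].
rewrite -(cardsID B A) (finset.setIidPr BA) leq_add ?leq_imset_card//.
have linj : {in A :\: B &, injective line}.
  move=> p q; rewrite !inE => /andP[pB pA] /andP[qB qA] lpq.
  have noB u s : u \in A -> s \in A -> step u s -> u \in B.
    by move=> uA sA us; apply/imsetP; exists (u, s) => //; rewrite inE us uA sA.
  apply: inj => //; case: (ltngtP (key p) (key q)) => // pq.
    by have [s sA ps] := next _ _ pA qA lpq pq; case/negP: pB; exact: noB ps.
  by have [s sA ps] := next _ _ qA pA (esym lpq) pq; case/negP: qB; exact: noB ps.
by rewrite -(card_in_imset linj) max_card.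
Qed.

(** The six neighbour directions exclude one another, so their indicators may be added up without
    counting a contact twice. *)
Lemma hex_steps_disjoint (a b a' b' : nat) :
  ((a == a'.+1) && (b == b') + (a == a') && (b == b'.+1) +
   (a == a'.+1) && (b.+1 == b') +
   ((a' == a.+1) && (b' == b) + (a' == a) && (b' == b.+1) +
    (a' == a.+1) && (b'.+1 == b)) <= 1)%N.
Proof.
have [h|h|->] := ltngtP a a'.
- rewrite (_ : a == a'.+1 = false) /=; last lia.
  rewrite !add0n; case: (a' == a.+1) => //=. lia.
- rewrite (_ : a' == a.+1 = false) /=; last lia.
  rewrite !addn0; case: (a == a'.+1) => //=. lia.
rewrite (_ : a' == a'.+1 = false) /=; last lia.
rewrite add0n !addn0. lia.
Qed.

Section Lattice.
Variables (R : realType) (c : nat).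

(** Triangular lattice with generators [(sqrt 3 / 2, 1 / 2)] and [(sqrt 3 / 2, - 1 / 2)]; the index
    pair [(c, c)] sits at the origin. *)
Definition lattice_point n (p : 'I_n * 'I_n) : 'cV[R]_2 :=
  \col_i (if i == 0 then Num.sqrt 3 / 2 * (p.1%:R + p.2%:R - 2 * c%:R)
          else (p.1%:R - p.2%:R) / 2).

Lemma lattice_sqdist n (p q : 'I_n * 'I_n) :
  plane_sqdist (lattice_point p) (lattice_point q) =
  ((p.1%:Z - q.1%:Z) ^+ 2 + (p.1%:Z - q.1%:Z) * (p.2%:Z - q.2%:Z) +
   (p.2%:Z - q.2%:Z) ^+ 2)%:~R.
Proof.
rewrite /plane_sqdist !mxE /= -mulrBr exprMn expr_div_n sqr_sqrtr//.
rewrite !(rmorphD, rmorphM, rmorphB, rmorphXn) /= -!pmulrn.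
by field.
Qed.

(** Four times the norm form is [3 u^2 + (2 v + u)^2], at least 3 if [u] is nonzero and
    symmetrically for [v]; integrality lifts [3 / 4] to 1. *)
Lemma lattice_far n (p q : 'I_n * 'I_n) : p != q ->
  1 <= plane_sqdist (lattice_point p) (lattice_point q).
Proof.
move=> pq; rewrite lattice_sqdist -[1]/(1%:~R) ler_int.
have : (p.1 != q.1 :> nat) || (p.2 != q.2 :> nat).
  by move: pq; case: p q => [a b] [a' b']; rewrite xpair_eqE negb_and.
move: (p.1 : nat) (p.2 : nat) (q.1 : nat) (q.2 : nat) => a b a' b' ab.
set u := a%:Z - a'%:Z; set v := b%:Z - b'%:Z.
have /orP uv : (u != 0) || (v != 0) by move: ab; rewrite /u /v; lia.
have sq1 (w : int) : w != 0 -> 1 <= w ^+ 2 by rewrite expr2; nia.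
have hu := sqr_ge0 (2 * u + v); have hv := sqr_ge0 (2 * v + u).
rewrite !expr2 in hu hv *; move: uv hu hv => [] /sq1; rewrite expr2; lia.
Qed.

Variables (n L k lo : nat) (m : nat -> nat -> bool).
Let A := [set p : 'I_n * 'I_n | m p.1 p.2].
Hypothesis m_dom : forall i j, m i j -> [/\ i < n, j < n & lo <= i + j <= lo + L]%N.
Hypothesis m1 : forall i i' j, m i j -> m i' j -> (i < i')%N -> m i.+1 j.
Hypothesis m2 : forall i j j', m i j -> m i j' -> (j < j')%N -> m i j.+1.
Hypothesis m3 : forall i j i' j', m i j -> m i' j' -> (i + j = i' + j')%N ->
  (i < i')%N -> m i.+1 j.-1.
Hypothesis perimeter : (n + n + L = 6 * k + 2)%N.
Hypothesis cardA : #|A| = (3 * k ^ 2 + 2 * k + 1)%N.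

Let T := ('I_n * 'I_n)%type.
Let step1 (p q : T) := (q.1 == p.1.+1 :> nat) && (q.2 == p.2 :> nat).
Let step2 (p q : T) := (q.1 == p.1 :> nat) && (q.2 == p.2.+1 :> nat).
Let step3 (p q : T) := (q.1 == p.1.+1 :> nat) && (q.2.+1 == p.2 :> nat).
Let E (step : rel T) := [set d : T * T | [&& step d.1 d.2, d.1 \in A & d.2 \in A]].

Lemma pair_ord_inj (p q : T) : p.1 = q.1 :> nat -> p.2 = q.2 :> nat -> p = q.
Proof. by case: p q => [? ?] [? ?] /= /val_inj -> /val_inj ->. Qed.

Lemma step1_count : (#|A| <= #|E step1| + n)%N.
Proof.
rewrite -[X in (_ + X)%N]card_ord.
apply: (card_le_steps (line := fun p : T => p.2) (key := fun p : T => p.1)).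
  move=> p q; rewrite !inE => mp mq pq lt; rewrite -pq in mq.
  have mS := m1 mp mq lt; have [h1 _ _] := m_dom mS.
  by exists (Ordinal h1, p.2); rewrite ?inE// /step1 /= !eqxx.
by move=> p q _ _ e1 e2; apply: pair_ord_inj => //; rewrite e1.
Qed.

Lemma step2_count : (#|A| <= #|E step2| + n)%N.
Proof.
rewrite -[X in (_ + X)%N]card_ord.
apply: (card_le_steps (line := fun p : T => p.1) (key := fun p : T => p.2)).
  move=> p q; rewrite !inE => mp mq pq lt; rewrite -pq in mq.
  have mS := m2 mp mq lt; have [_ h1 _] := m_dom mS.
  by exists (p.1, Ordinal h1); rewrite ?inE// /step2 /= !eqxx.
by move=> p q _ _ e1 e2; apply: pair_ord_inj => //; rewrite e1.
Qed.

Lemma step3_count : (#|A| <= #|E step3| + L.+1)%N.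
Proof.
rewrite -[X in (_ + X)%N]card_ord.
pose line (p : T) : 'I_L.+1 := inord (p.1 + p.2 - lo).
have lineP p q : p \in A -> q \in A -> line p = line q ->
    (p.1 + p.2 = q.1 + q.2)%N.
  rewrite !inE => /m_dom[_ _ /andP[p1 p2]] /m_dom[_ _ /andP[q1 q2]].
  by move=> /(congr1 val); rewrite /= !inordK; lia.
apply: (card_le_steps (line := line) (key := fun p : T => p.1)).
  move=> p q pA qA /(lineP _ _ pA qA) pq /= lt; move: pA qA; rewrite !inE => mp mq.
  have mS := m3 mp mq pq lt; have [h1 h2 _] := m_dom mS.
  have p0 : (0 < p.2)%N by rewrite -(ltn_add2l p.1) addn0 pq (leq_trans lt) ?leq_addr.
  by exists (Ordinal h1, Ordinal h2); rewrite ?inE// /step3 /= prednK ?eqxx.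
move=> p q pA qA /(lineP _ _ pA qA) pq e; apply: pair_ord_inj => //.
by move: pq; rewrite e => /addnI.
Qed.

(** Each of the three directions has at least [#|A|] steps minus its number of lines, and there are
    [n + n + (L + 1) = 6 k + 3] lines in all; every step gives two ordered pairs. *)
Lemma contact_pairs_ge :
  (6 * #|A| <= #|[set d : T * T | [&& plane_sqdist (lattice_point d.1) (lattice_point d.2) == 1%R,
     d.1 \in A & d.2 \in A]]| + 12 * k + 6)%N.
Proof.
set D := [set d : T * T | _].
suff : (2 * (#|E step1| + #|E step2| + #|E step3|) <= #|D|)%N.
  have := step1_count; have := step2_count; have := step3_count; lia.
have swapE step : #|E step| = #|E (fun p q => step q p)|.
  have sinj : injective (fun d : T * T => (d.2, d.1)) by move=> [a b] [c' d] /= [-> ->].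
  rewrite -(card_imset _ sinj); apply: eq_card => -[a b]; apply/imsetP/idP.
    by move=> [[a' b']]; rewrite !inE /= => /and3P[? ? ?] [-> ->]; apply/and3P.
  by rewrite !inE /= => /and3P[? ? ?]; exists (b, a); rewrite // !inE /=; apply/and3P.
have cE step : #|E step| =
    (\sum_(d in [set d : T * T | (d.1 \in A) && (d.2 \in A)]) step d.1 d.2)%N.
  rewrite -sum1_card big_mkcond [RHS]big_mkcond; apply: eq_bigr => d _.
  by rewrite !inE; case: (step _ _) => //=; case: ifP.
have -> : #|D| = (\sum_(d in [set d : T * T | (d.1 \in A) && (d.2 \in A)])
    (plane_sqdist (lattice_point d.1) (lattice_point d.2) == 1%R))%N.
  rewrite -sum1_card big_mkcond [RHS]big_mkcond; apply: eq_bigr => d _.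
  by rewrite !inE; case: (_ == 1) => //=; case: ifP.
(* One copy of each step count is reversed, so that all six directions appear in the termwise
   comparison. *)
rewrite mul2n -addnn {1}(swapE step1) {1}(swapE step2) {1}(swapE step3) !cE -!big_split.
apply: leq_sum => -[[a b] [a' b']] _ /=; rewrite lattice_sqdist /=.
rewrite -[1 : R]/(1%:~R) eqr_int /step1 /step2 /step3 /=.
set z := (X in X == 1).
have z1 : (a' == a.+1 :> nat) && (b' == b :> nat) -> z = 1.
  by move=> /andP[/eqP h /eqP h']; rewrite /z h h'; lia.
have z2 : (a' == a :> nat) && (b' == b.+1 :> nat) -> z = 1.
  by move=> /andP[/eqP h /eqP h']; rewrite /z h h'; lia.
have z3 : (a' == a.+1 :> nat) && (b'.+1 == b :> nat) -> z = 1.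
  by move=> /andP[/eqP h /eqP h']; rewrite /z h -h'; lia.
have z4 : (a == a'.+1 :> nat) && (b == b' :> nat) -> z = 1.
  by move=> /andP[/eqP h /eqP h']; rewrite /z h h'; lia.
have z5 : (a == a' :> nat) && (b == b'.+1 :> nat) -> z = 1.
  by move=> /andP[/eqP h /eqP h']; rewrite /z h h'; lia.
have z6 : (a == a'.+1 :> nat) && (b.+1 == b' :> nat) -> z = 1.
  by move=> /andP[/eqP h /eqP h']; rewrite /z h -h'; lia.
have [_|/eqP nz] := eqVneq z 1; first exact: hex_steps_disjoint.
have z0 (P : bool) : (P -> z = 1) -> P = false by case: P => // /(_ isT).
by rewrite !(z0 _ z1, z0 _ z2, z0 _ z3, z0 _ z4, z0 _ z5, z0 _ z6).
Qed.

Theorem lattice_ground_state :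
  ground_state #|A| [fset lattice_point p | p in A]%fset.
Proof.
pose x (i : 'I_#|A|) := lattice_point (enum_val i).
have -> : [fset lattice_point p | p in A]%fset = [fset x i | i : 'I_#|A|]%fset.
  apply/fsetP => v; apply/imfsetP/imfsetP => /= [[p pA ->]|[i _ ->]].
    by exists (enum_rank_in pA p); rewrite // /x enum_rankK_in.
  by exists (enum_val i) => //; exact: enum_valP.
apply: (ground_state_image cardA).
  by move=> i j ij; apply: lattice_far; rewrite (inj_eq enum_val_inj).
apply: leq_trans contact_pairs_ge _; rewrite !leq_add2r.
rewrite -(card_imset (contacts x) (f := fun d => (enum_val d.1, enum_val d.2))); last first.
  by move=> [a b] [c' d] /= [/enum_val_inj-> /enum_val_inj->].
apply/subset_leq_card/fintype.subsetP => -[p q]; rewrite inE /= => /and3P[pq pA qA].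
apply/imsetP; exists (enum_rank_in pA p, enum_rank_in qA q); rewrite /= ?enum_rankK_in//.
by rewrite inE /x /= !enum_rankK_in.
Qed.

End Lattice.

(** * Moments of hexagons *)

(* With b = i - B and c = j - B this is max(|b|, |c|) <= B, |b + c| <= 2 B - q. *)
Definition hexagon (B q i j : nat) :=
  [&& i < (2 * B).+1, j < (2 * B).+1, q <= i + j & i + j + q <= 4 * B]%N.

Section HexagonSums.
Variable R : realFieldType.
Implicit Types (B q n : nat) (g : nat -> nat -> R).

(** Sum over the triangle [i + j < q], the part of the square that the hexagon omits at each of two
    opposite corners. *)
Definition corner_sum q g : R := \sum_(i < q) \sum_(j < q - i) g i j.

Lemma corner_sumS q g :
  corner_sum q.+1 g = corner_sum q g + \sum_(i < q.+1) g i (q - i)%N.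
Proof.
rewrite /corner_sum big_ord_recr /= subSnn big_ord1 [in RHS]big_ord_recr /=.
rewrite subnn addrA; congr (_ + _); rewrite -big_split; apply: eq_bigr => i _.
by rewrite (subSn (ltnW (ltn_ord i))) big_ord_recr.
Qed.

Lemma corner_sumE n q g : (q <= n)%N ->
  corner_sum q g = \sum_(i < n) \sum_(j < n) (if (i + j < q)%N then g i j else 0).
Proof.
move=> qn; rewrite /corner_sum.
rewrite (big_ord_widen n (fun i => \sum_(j < q - i) g i j)) // big_mkcond.
apply: eq_bigr => i _; case: ltnP => iq.
  rewrite (big_ord_widen n (g i)); last lia.
  by rewrite big_mkcond; apply: eq_bigr => j _; rewrite ltn_subRL.
by rewrite big1// => j _; rewrite ifF//; lia.
Qed.

(** Square minus two corner triangles: [q <= 2 B] keeps them disjoint, and central symmetry of [g]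
    makes their sums equal. *)
Lemma hexagon_sum B q g : (q <= 2 * B)%N ->
  (forall i j, (i <= 2 * B)%N -> (j <= 2 * B)%N -> g (2 * B - i)%N (2 * B - j)%N = g i j) ->
  \sum_(p : 'I_(2 * B).+1 * 'I_(2 * B).+1 | hexagon B q p.1 p.2) g p.1 p.2 =
  \sum_(i < (2 * B).+1) \sum_(j < (2 * B).+1) g i j - 2 * corner_sum q g.
Proof.
move=> qB gsym; have qn : (q <= (2 * B).+1)%N by lia.
have C2 : corner_sum q g = \sum_(i < (2 * B).+1) \sum_(j < (2 * B).+1)
    (if (4 * B < i + j + q)%N then g i j else 0).
  rewrite (corner_sumE g qn) (reindex_inj rev_ord_inj); apply: eq_bigr => i _.
  rewrite (reindex_inj rev_ord_inj); apply: eq_bigr => j _ /=.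
  have hi := ltn_ord i; have hj := ltn_ord j.
  rewrite (subSS i) (subSS j) gsym//; congr (if _ then _ else _); lia.
have -> : 2 * corner_sum q g = corner_sum q g + corner_sum q g by ring.
rewrite {1}(corner_sumE g qn) C2 big_mkcond.
rewrite -(pair_big xpredT xpredT (fun i j : 'I_(2 * B).+1 =>
  if hexagon B q i j then g i j else 0)) /= -big_split -sumrB.
apply: eq_bigr => i _; rewrite -big_split -sumrB; apply: eq_bigr => j _ /=.
rewrite /hexagon !ltn_ord /=; have := ltn_ord i; have := ltn_ord j => hi hj.
have [h1|h1] := leqP q (i + j); have [h2|h2] := leqP (i + j + q) (4 * B).
- by rewrite addr0 subr0.
- by rewrite add0r subrr.
- by rewrite addr0 subrr.
- by exfalso; lia.
Qed.

Lemma sum_cst n (a : R) : \sum_(i < n) a = n%:R * a.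
Proof. by rewrite sumr_const card_ord mulr_natl. Qed.

Lemma sum_shift n (a : R) :
  \sum_(i < n) (i%:R - a) = n%:R * (n%:R - 1) / 2 - n%:R * a.
Proof.
elim: n => [|n IH]; first by rewrite big_ord0 !mul0r subrr.
by rewrite big_ord_recr /= IH -natr1; field.
Qed.

Lemma sum_shift_sqr n (a : R) : \sum_(i < n) (i%:R - a) ^+ 2 =
  n%:R * (n%:R - 1) * (2 * n%:R - 1) / 6 - a * n%:R * (n%:R - 1) + n%:R * a ^+ 2.
Proof.
elim: n => [|n IH]; first by rewrite big_ord0 !(mul0r, mulr0, subrr, addr0).
by rewrite big_ord_recr /= IH -natr1; field.
Qed.

(** The values [s = 1] and [s = -1] serve the sum and the difference of the indices; the mixed term
    vanishes because the box is centred. *)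
Lemma box_sum B (s : R) : s ^+ 2 = 1 ->
  \sum_(i < (2 * B).+1) \sum_(j < (2 * B).+1)
    ((i%:R - B%:R) + s * (j%:R - B%:R)) ^+ 2 =
  2 * (2 * B%:R + 1) ^+ 2 * B%:R * (B%:R + 1) / 3 :> R.
Proof.
move=> s2; set n := (2 * B).+1.
have nE : n%:R = 2 * B%:R + 1 :> R by rewrite /n -natr1 natrM.
have S1 : \sum_(j < n) (j%:R - B%:R) = 0 :> R.
  by rewrite sum_shift nE; field.
have S2 : \sum_(j < n) (j%:R - B%:R) ^+ 2 = (2 * B%:R + 1) * B%:R * (B%:R + 1) / 3 :> R.
  by rewrite sum_shift_sqr nE; field.
have inner (u : R) : \sum_(j < n) (u + s * (j%:R - B%:R)) ^+ 2 =
    n%:R * u ^+ 2 + (2 * B%:R + 1) * B%:R * (B%:R + 1) / 3.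
  rewrite (eq_bigr (fun j : 'I_n => u ^+ 2 + (2 * s * u) * (j%:R - B%:R) + (j%:R - B%:R) ^+ 2)).
    by rewrite !big_split /= sum_cst S2 -mulr_sumr S1 mulr0 addr0.
  by move=> j _; rewrite sqrrD exprMn s2; ring.
under eq_bigr do rewrite inner.
by rewrite big_split /= sum_cst -mulr_sumr S2 nE; field.
Qed.

Lemma corner_card q : corner_sum q (fun _ _ => 1) = q%:R * (q%:R + 1) / 2.
Proof.
elim: q => [|q IH]; first by rewrite /corner_sum big_ord0 !mul0r.
by rewrite corner_sumS IH sum_cst -natr1; field.
Qed.

Lemma corner_sum_sqr q (c : R) : corner_sum q (fun i j => (i%:R + j%:R - c) ^+ 2) =
  c ^+ 2 * q%:R * (q%:R + 1) / 2 - 2 * c * (q%:R - 1) * q%:R * (q%:R + 1) / 3 +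
  (q%:R * (q%:R - 1)) ^+ 2 / 4 + (q%:R - 1) * q%:R * (2 * q%:R - 1) / 6.
Proof.
elim: q => [|q IH]; first by rewrite /corner_sum big_ord0; ring.
rewrite corner_sumS IH (eq_bigr (fun _ => (q%:R - c) ^+ 2)) => [|i _].
  by rewrite sum_cst -natr1; field.
have iq : (i <= q)%N by rewrite -ltnS.
by rewrite -natrD subnKC.
Qed.

Lemma corner_diff_sqr q : corner_sum q (fun i j => (i%:R - j%:R) ^+ 2) =
  (q%:R - 1) * q%:R * (q%:R + 1) * (q%:R + 2) / 12.
Proof.
elim: q => [|q IH]; first by rewrite /corner_sum big_ord0; ring.
rewrite corner_sumS IH (eq_bigr (fun i : 'I_q.+1 => 4 * (i%:R - q%:R / 2) ^+ 2)) => [|i _].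
  by rewrite -mulr_sumr sum_shift_sqr -natr1; field.
have iq : (i <= q)%N by rewrite -ltnS.
by rewrite natrB//; field.
Qed.

Lemma hexagon_card B q : (q <= 2 * B)%N ->
  #|[set p : 'I_(2 * B).+1 * 'I_(2 * B).+1 | hexagon B q p.1 p.2]|%:R =
  (2 * B%:R + 1) ^+ 2 - q%:R * (q%:R + 1) :> R.
Proof.
move=> qB; rewrite -sum1_card natr_sum.
under eq_bigl do rewrite inE.
rewrite (hexagon_sum (g := fun _ _ => 1))// corner_card.
under eq_bigr do rewrite sum_cst.
by rewrite sum_cst -natr1 natrM; field.
Qed.

Lemma hexagon_sum_sqr B q : (q <= 2 * B)%N ->
  \sum_(p : 'I_(2 * B).+1 * 'I_(2 * B).+1 | hexagon B q p.1 p.2)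
    (p.1%:R + p.2%:R - 2 * B%:R) ^+ 2 =
  2 * (2 * B%:R + 1) ^+ 2 * B%:R * (B%:R + 1) / 3 -
  2 * corner_sum q (fun i j => (i%:R + j%:R - 2 * B%:R) ^+ 2) :> R.
Proof.
move=> qB; rewrite (hexagon_sum (g := fun i j => (i%:R + j%:R - 2 * B%:R) ^+ 2))//.
  congr (_ - _); rewrite -(@box_sum B 1) ?expr1n//.
  by apply: eq_bigr => i _; apply: eq_bigr => j _; congr (_ ^+ 2); ring.
by move=> i j iB jB; rewrite !natrB// natrM; ring.
Qed.

Lemma hexagon_diff_sqr B q : (q <= 2 * B)%N ->
  \sum_(p : 'I_(2 * B).+1 * 'I_(2 * B).+1 | hexagon B q p.1 p.2)
    (p.1%:R - p.2%:R) ^+ 2 =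
  2 * (2 * B%:R + 1) ^+ 2 * B%:R * (B%:R + 1) / 3 -
  2 * corner_sum q (fun i j => (i%:R - j%:R) ^+ 2) :> R.
Proof.
move=> qB; rewrite (hexagon_sum (g := fun i j => (i%:R - j%:R) ^+ 2))//.
  congr (_ - _); rewrite -(@box_sum B (-1)) ?sqrrN ?expr1n//.
  by apply: eq_bigr => i _; apply: eq_bigr => j _; congr (_ ^+ 2); ring.
by move=> i j iB jB; rewrite !natrB// natrM; ring.
Qed.

(** In the plane the coordinates are [sqrt 3 / 2] times the sum and [1 / 2] times the difference, so
    the factor 3 says that both axes carry the same second moment. The closed forms confirm it. *)
Lemma hexagon_isotropic k :
  \sum_(p : 'I_(2 * k).+1 * 'I_(2 * k).+1 | hexagon k k p.1 p.2) (p.1%:R - p.2%:R) ^+ 2 =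
  3 * \sum_(p : 'I_(2 * k).+1 * 'I_(2 * k).+1 | hexagon k k p.1 p.2)
    (p.1%:R + p.2%:R - 2 * k%:R) ^+ 2 :> R.
Proof.
have k2 : (k <= 2 * k)%N by lia.
rewrite (hexagon_sum_sqr k2) (hexagon_diff_sqr k2) corner_sum_sqr corner_diff_sqr.
by field.
Qed.

Lemma hexagon_gain m k : (0 < m)%N -> k = (12 * m ^ 2)%N ->
  \sum_(p : 'I_(2 * k).+1 * 'I_(2 * k).+1 | hexagon k k p.1 p.2)
    (p.1%:R + p.2%:R - 2 * k%:R) ^+ 2 + m%:R * k%:R ^+ 3 <=
  \sum_(p : 'I_(2 * (k - m)).+1 * 'I_(2 * (k - m)).+1 | hexagon (k - m) (k - 4 * m) p.1 p.2)
    (p.1%:R + p.2%:R - 2 * (k - m)%:R) ^+ 2 :> R.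
Proof.
move=> m0 kE.
have mk : (4 * m <= k)%N by rewrite kE; nia.
have k2 : (k <= 2 * k)%N by lia.
have k4 : (k - 4 * m <= 2 * (k - m))%N by lia.
rewrite !hexagon_sum_sqr// !corner_sum_sqr (natrB R mk).
rewrite (natrB R (_ : m <= k)%N); last by lia.
have -> : k%:R = 12 * m%:R ^+ 2 :> R by rewrite kE natrM natrX.
rewrite natrM; have : 1 <= m%:R :> R by rewrite ler1n.
move: (m%:R : R) => {m m0 kE mk k4 k2} m m1.
have p j : m ^+ j <= m ^+ j.+1 by rewrite exprS ler_peMl// exprn_ge0//; lra.
have := p 2; have := p 3; have := p 4%N; have := p 5; have := p 6.
have := p 1%N; have := p 0%N; rewrite expr0 expr1.
move=> ? ? ? ? ? ? ?; rewrite -subr_ge0.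
(* Substituting [k = 12 m^2] leaves a polynomial in [m] alone, nonnegative by comparing consecutive
   powers of [m >= 1]. *)
rewrite [X in 0 <= X](_ : _ = 2880 * m ^+ 7 - 576 * m ^+ 6 + 320 * m ^+ 5
  - (48 + 56 / 3) * m ^+ 4 + (32 - 32 / 3) * m ^+ 3 + 2 / 3 * m ^+ 2 + 2 / 3 * m).
  lra.
by field.
Qed.

End HexagonSums.

(** * The flat norm *)

Local Open Scope classical_set_scope.
Local Open Scope ring_scope.

(** For any Hahn decomposition [pos + nu] and [neg + mu] are the same measure; integrating a
    function with values in [[0, 1]] gives finite terms that can be rearranged. *)
Lemma charge_integral_sub d (T : measurableType d) (R : realType)
    (rho : {charge set T -> \bar R}) (mu nu : {finite_measure set T -> \bar R})
    (f : T -> R) :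
  (forall A, measurable A -> rho A = mu A - nu A)%E ->
  measurable_fun setT f -> (forall x, 0 <= f x <= 1) ->
  charge_integral rho f = (\int[mu]_x (f x)%:E - \int[nu]_x (f x)%:E)%E.
Proof.
move=> rhoE mf f01; rewrite /charge_integral.
suff H P N (nuPN : hahn_decomposition rho P N) :
    (\int[jordan_pos nuPN]_x (f x)%:E - \int[jordan_neg nuPN]_x (f x)%:E =
     \int[mu]_x (f x)%:E - \int[nu]_x (f x)%:E)%E by exact: H.
set pos := jordan_pos nuPN; set neg := jordan_neg nuPN.
have /measurable_EFinP mE := mf.
have f0 x : setT x -> (0 <= (f x)%:E)%E by move=> _; rewrite lee_fin; case/andP: (f01 x).
have fin (m : {finite_measure set T -> \bar R}) : (\int[m]_x (f x)%:E)%E \is a fin_num.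
  rewrite ge0_fin_numE; last exact: integral_ge0.
  apply: (@le_lt_trans _ _ (\int[m]_x (cst 1%E x))%E).
    apply: ge0_le_integral => //.
    by move=> x _; rewrite lee_fin; case/andP: (f01 x).
  by rewrite integral_cst// mul1e ltey_eq fin_num_measure.
have E : (\int[pos]_x (f x)%:E + \int[nu]_x (f x)%:E =
    \int[neg]_x (f x)%:E + \int[mu]_x (f x)%:E)%E.
  rewrite -!ge0_integral_measure_add//; apply: eq_measure_integral => A mA _.
  transitivity (pos A + nu A)%E; first exact: measure_addE.
  transitivity (neg A + mu A)%E; last by exact/esym/measure_addE.
  have : (mu A - nu A = pos A - neg A)%E.
    by rewrite -rhoE// (jordan_decomp nuPN mA) /cadd /= cscaleN1.
  have : (mu A \is a fin_num)%E by exact: fin_num_measure.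
  have : (nu A \is a fin_num)%E by exact: fin_num_measure.
  have : (pos A \is a fin_num)%E by exact: fin_num_measure.
  have : (neg A \is a fin_num)%E by exact: fin_num_measure.
  rewrite -/pos -/neg.
  move: (mu A) (nu A) (pos A) (neg A) => [a| |] [b| |] [c| |] [e| |] //= _ _ _ _.
  rewrite -!EFinB -!EFinD => -[h]; congr EFin; lra.
move: (fin mu) (fin nu) (fin pos) (fin neg) E.
move: (\int[mu]_x _)%E (\int[nu]_x _)%E (\int[pos]_x _)%E (\int[neg]_x _)%E.
move=> [a| |] [b| |] [c| |] [e| |] //= _ _ _ _.
by rewrite -!EFinB -!EFinD => -[h]; congr EFin; lra.
Qed.

Section FlatNorm.
Variable R : realType.
Local Notation plane := ('cV[R]_2).

Lemma enorm_le (u : plane) : enorm u <= 2 * `|u|.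
Proof.
have le i : `|u i 0| <= `|u|.
  rewrite [leRHS]mx_normrE.
  exact: (le_bigmax _ (fun ij : 'I_2 * 'I_1 => `|u ij.1 ij.2|) (i, 0)).
rewrite /enorm -[leRHS](@ger0_norm _ (2 * `|u|)) ?mulr_ge0// -sqrtr_sqr.
apply: ler_wsqrtr; rewrite big_ord_recl big_ord1.
have sqr_le i : u i 0 ^+ 2 <= `|u| ^+ 2.
  by rewrite -[leLHS]real_normK ?num_real// ler_sqr ?nnegrE.
have := sqr_le (ord0 : 'I_2); have := sqr_le (lift ord0 ord0 : 'I_2).
by have := sqr_ge0 `|u|; rewrite exprMn; lra.
Qed.

Lemma lipschitz_measurable (f : plane -> R) :
  (forall x y, `|f x - f y| <= enorm (x - y)) ->
  measurable_fun setT (f : borel_plane R -> R).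
Proof.
move=> lip; apply: (measurability _ (RGenOInfty.measurableE R)).
move=> _ [_ [r ->] <-]; rewrite setTI; apply: sub_sigma_algebra.
rewrite /= openE => y /=; rewrite in_itv /= andbT => ry.
apply/nbhs_ballP; exists ((f y - r) / 2); first by rewrite /= divr_gt0// subr_gt0.
move=> z; rewrite -ball_normE /= in_itv /= andbT => yz.
have := le_lt_trans (le_trans (lip y z) (enorm_le _)) _.
move=> /(_ (f y - r)); rewrite ltr_norml; lra.
Qed.

Lemma integral_diracs (nu : {measure set (borel_plane R) -> \bar R}) (r : {nonneg R})
    (s : seq plane) (f : borel_plane R -> R) :
  (forall A, measurable A ->
    nu A = (r%:num%:E * \sum_(x <- s) \d_(x : borel_plane R) A)%E) ->
  measurable_fun setT f -> (forall x, 0 <= f x) ->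
  (\int[nu]_x (f x)%:E = (r%:num * \sum_(x <- s) f x)%:E)%E.
Proof.
move=> nuE mf f0.
pose m := fun k : nat => dirac (nth 0 s k : borel_plane R) : {measure set _ -> \bar R}.
have /measurable_EFinP mE := mf.
have fE x : setT x -> (0 <= (f x)%:E)%E by rewrite lee_fin.
rewrite (@eq_measure_integral _ _ _ _ (mscale r (msum m (size s)))); last first.
  move=> A mA _; rewrite nuE// /mscale /msum /=.
  by rewrite (big_nth 0) big_mkord.
rewrite ge0_integral_mscale// ge0_integral_measure_sum//.
rewrite EFinM; congr (_ * _)%E; rewrite (big_nth 0) big_mkord -sumEFin.
apply: eq_bigr => i _; rewrite integral_dirac// diracT mul1e.
by [].
Qed.

(** A single test function bounds the supremum from below; the moved measure has its atoms at the
    preimages [Q^T (x - a)] of the original atoms. *)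
Lemma flat_norm_ge N (S S' : {fset plane}) (Q : orthogonal2 R) (a : plane)
    (f : plane -> R) :
  (forall x, 0 <= f x <= 1) -> (forall x y, `|f x - f y| <= enorm (x - y)) ->
  ((N%:R^-1 * \sum_(x <- S) f ((Num.sqrt N%:R)^-1 *: x) -
    N%:R^-1 * \sum_(x <- S') f ((Q : 'M[R]_2)^T *m ((Num.sqrt N%:R)^-1 *: x - a)))%:E <=
  flat_norm (cadd (empirical_measure N S)
    (copp (moved_measure (empirical_measure N S') Q a))))%E.
Proof.
move=> f01 lip; apply: ereal_sup_ubound; exists f.
  by split=> // x; rewrite ger0_norm; case/andP: (f01 x).
have mf := lipschitz_measurable lip.
have f0 x : 0 <= f x by case/andP: (f01 x).
rewrite (charge_integral_sub (mu := empirical_measure N S)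
  (nu := moved_measure (empirical_measure N S') Q a))// EFinB; congr (_ - _)%E.
  rewrite (integral_diracs (r := (N%:R^-1)%:nng)
    (s := [seq (Num.sqrt N%:R)^-1 *: x | x <- S]))//=; first by rewrite big_map.
  by move=> A mA; rewrite big_map.
rewrite (integral_diracs (r := (N%:R^-1)%:nng)
  (s := [seq (Q : 'M[R]_2)^T *m ((Num.sqrt N%:R)^-1 *: x - a) | x <- S']))//=.
  by rewrite big_map.
move=> A mA; rewrite big_map /moved_measure /empirical_measure; congr (_ * _)%E.
apply: eq_bigr => x _; rewrite !diracE; congr (_%:R%:E); congr nat_of_bool.
apply/idP/idP => /[!inE].
  move=> [y Ay <-]; rewrite /isometry_of addrK mulmxA.
  by rewrite (mulmx1C (orthogonal2P Q)) mul1mx.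
move=> Ax; exists ((Q : 'M[R]_2)^T *m ((Num.sqrt N%:R)^-1 *: x - a)) => //.
by rewrite /isometry_of mulmxA orthogonal2P mul1mx subrK.
Qed.

(** * Detecting a second moment gap with a clipped quadratic *)

Definition dot (w y : plane) : R := w 0 0 * y 0 0 + w 1 0 * y 1 0.

(** Halving makes the clipped quadratic 1-Lipschitz; the sign gives the wider configuration the
    smaller integral. *)
Definition strip_test (w y : plane) : R := (1 - Num.min (dot w y ^+ 2) 1) / 2.

(** The square has slope at most 2 on [[-1, 1]], and the minimum is constant outside. *)
Lemma min_sqr_lipschitz (s t : R) :
  `|Num.min (s ^+ 2) 1 - Num.min (t ^+ 2) 1| <= 2 * `|s - t|.
Proof.
wlog st : s t / `|s| <= `|t| => [H|].
  by case: (leP `|s| `|t|) => [/H//|/ltW/H]; rewrite distrC (distrC t).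
have tri : `|t| - `|s| <= `|s - t| by rewrite (distrC s) lerB_dist.
rewrite -[s ^+ 2]real_normK ?num_real// -[t ^+ 2]real_normK ?num_real//.
move: (normr_ge0 s) tri st; move: `|s| `|t| `|s - t| => p q d p0 pqd pq.
rewrite distrC ger0_norm; last by rewrite subr_ge0 le_min2// ler_sqr ?nnegrE// (le_trans p0).
have q0 := le_trans p0 pq.
have le1 z : 0 <= z -> (z ^+ 2 <= 1) = (z <= 1) by move=> z0; rewrite expr_le1.
case: (leP (p ^+ 2) 1) => hp; case: (leP (q ^+ 2) 1) => hq; try lra.
  move: hq; rewrite le1// => q1.
  have : 0 <= (q - p) * (2 - q - p) by apply: mulr_ge0; lra.
  lra.
move: hq; rewrite ltNge le1// -ltNge => q1; have := sqr_ge0 (1 - p); lra.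
Qed.

Lemma strip_test01 w y : 0 <= strip_test w y <= 1.
Proof.
rewrite /strip_test; have := sqr_ge0 (dot w y).
by case: (leP (dot w y ^+ 2) 1) => ? ?; apply/andP; split; lra.
Qed.

Lemma dotB w x y : dot w (x - y) = dot w x - dot w y.
Proof. by rewrite /dot !mxE; ring. Qed.

Lemma dot_enorm (w y : plane) : w 0 0 ^+ 2 + w 1 0 ^+ 2 = 1 -> `|dot w y| <= enorm y.
Proof.
move=> w1; rewrite /enorm -sqrtr_sqr; apply: ler_wsqrtr.
rewrite big_ord_recl big_ord1 (_ : lift _ _ = 1); last exact: val_inj.
rewrite /dot -subr_ge0 -[y 0 0 ^+ 2 + _]mul1r -w1.
rewrite (_ : _ - _ = (w 0 0 * y 1 0 - w 1 0 * y 0 0) ^+ 2); last by ring.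
exact: sqr_ge0.
Qed.

Lemma strip_test_lipschitz (w x y : plane) : w 0 0 ^+ 2 + w 1 0 ^+ 2 = 1 ->
  `|strip_test w x - strip_test w y| <= enorm (x - y).
Proof.
move=> w1; apply: le_trans (dot_enorm (x - y) w1); rewrite dotB.
have := min_sqr_lipschitz (dot w x) (dot w y); rewrite /strip_test.
set p := Num.min _ _; set q := Num.min _ _.
have -> : (1 - p) / 2 - (1 - q) / 2 = - ((p - q) / 2) by field.
by rewrite normrN normrM (ger0_norm (x := 2^-1))//; lra.
Qed.

(* Pairing x with -x cancels the effect of the translation, because clipped
   squares satisfy this midpoint inequality near the origin. *)
Lemma min_sqr_midpoint (t a : R) : 2 * t ^+ 2 <= 1 ->
  2 * t ^+ 2 <= Num.min ((t - a) ^+ 2) 1 + Num.min ((- t - a) ^+ 2) 1.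
Proof.
move=> t1; have := sqr_ge0 (t - a); have := sqr_ge0 (- t - a); have := sqr_ge0 a.
have : (t - a) ^+ 2 + (- t - a) ^+ 2 = 2 * t ^+ 2 + 2 * a ^+ 2 by ring.
by case: (leP ((t - a) ^+ 2) 1) => ?; case: (leP ((- t - a) ^+ 2) 1) => ?; lra.
Qed.

(** In [G / (2 N^2)] one factor [N] comes from the mass of the atoms, the other from squaring the
    scale [1 / sqrt N], and the 2 from [strip_test]. *)
Lemma flat_norm_moment_gap N (S S' : {fset plane}) (I G : R) (Q : orthogonal2 R)
    (a : plane) :
  (0 < N)%N -> #|` S|%fset = N -> #|` S'|%fset = N ->
  (forall g : R -> R, \sum_(x <- S') g (x 0 0) = \sum_(x <- S') g (- x 0 0)) ->
  (forall x, x \in S' -> 2 * x 0 0 ^+ 2 <= N%:R) ->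
  (forall w : plane, w 0 0 ^+ 2 + w 1 0 ^+ 2 = 1 -> \sum_(x <- S) dot w x ^+ 2 <= I) ->
  I + G <= \sum_(x <- S') x 0 0 ^+ 2 ->
  ((G / (2 * N%:R ^+ 2))%:E <= flat_norm (cadd (empirical_measure N S)
    (copp (moved_measure (empirical_measure N S') Q a))))%E.
Proof.
move=> N0 SN S'N sym small iso gain.
(* Testing along the first row of [Q] turns the moved copy of [S'] back to its first coordinate. *)
pose w : plane := \col_i (Q : 'M[R]_2) 0 i.
have w1 : w 0 0 ^+ 2 + w 1 0 ^+ 2 = 1.
  have /matrixP/(_ 0 0) := orthogonal2P Q.
  rewrite !mxE big_ord_recl big_ord1 !mxE eqxx mulr1n.
  rewrite (_ : lift _ _ = 1); last exact: val_inj.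
  by rewrite !expr2.
have wQ z : dot w ((Q : 'M[R]_2)^T *m z) = z 0 0.
  have := congr1 (fun M => (M *m z) 0 0) (orthogonal2P Q).
  rewrite -mulmxA mul1mx => <-; rewrite /dot [RHS]mxE big_ord_recl big_ord1 /w !mxE.
  by rewrite (_ : lift _ _ = 1)//; exact: val_inj.
apply: le_trans (flat_norm_ge N S S' Q a (strip_test01 w) _); last first.
  by move=> x y; exact: strip_test_lipschitz.
rewrite lee_fin /strip_test.
set r := (Num.sqrt N%:R)^-1.
have n0 : 0 < N%:R :> R by rewrite ltr0n.
have r2 : r ^+ 2 = N%:R^-1 by rewrite exprVn sqr_sqrtr// ltW.
have cst (T : {fset plane}) (h : plane -> R) : #|` T|%fset = N ->
    \sum_(x <- T) (1 - h x) / 2 = (N%:R - \sum_(x <- T) h x) / 2.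
  by move=> TN; rewrite -mulr_suml sumrB big_const_seq count_predT TN iter_addr_0.
rewrite !cst//.
have upper : \sum_(x <- S) Num.min (dot w (r *: x) ^+ 2) 1 <= I / N%:R.
  apply: le_trans (_ : \sum_(x <- S) dot w x ^+ 2 / N%:R <= _); last first.
    by rewrite -mulr_suml ler_pM2r ?invr_gt0// iso.
  apply: ler_sum => x _; rewrite ge_min; apply/orP; left.
  have -> : dot w (r *: x) = r * dot w x by rewrite /dot !mxE; ring.
  by rewrite exprMn r2 mulrC.
have lower : (I + G) / N%:R <=
    \sum_(x <- S') Num.min (dot w ((Q : 'M[R]_2)^T *m (r *: x - a)) ^+ 2) 1.
  under eq_bigr do rewrite wQ !mxE.
  (* The sum over [S'] is taken twice, once reflected by [sym], so that opposite points can be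
     paired. *)
  have half (s t : R) : 2 * s <= t + t -> s <= t by lra.
  apply: half; rewrite [X in _ <= _ + X](sym (fun t => Num.min ((r * t - a 0 0) ^+ 2) 1)).
  rewrite -big_split /=.
  apply: le_trans (_ : \sum_(x <- S') 2 * (r * x 0 0) ^+ 2 <= _).
    rewrite -mulr_sumr ler_pM2l//; under eq_bigr do rewrite exprMn r2.
    by rewrite -mulr_sumr mulrC ler_pM2l ?invr_gt0.
  rewrite big_seq [leRHS]big_seq; apply: ler_sum => x xS.
  rewrite mulrN; apply: min_sqr_midpoint.
  by rewrite exprMn r2 mulrCA mulrC ler_pdivrMr// mul1r small.
rewrite -mulrBr -mulrBl.
set U := \sum_(x <- S) _ in upper *; set L := \sum_(x <- S') _ in lower *.
have -> : N%:R^-1 * ((N%:R - U - (N%:R - L)) / 2) = (L - U) / (2 * N%:R).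
  by field; rewrite gt_eqF.
have -> : G / (2 * N%:R ^+ 2) = ((I + G) / N%:R - I / N%:R) / (2 * N%:R).
  by field; rewrite gt_eqF.
by rewrite ler_pM2r ?invr_gt0 ?mulr_gt0//; lra.
Qed.

End FlatNorm.

(* Removing points from one end of a side keeps every lattice line in the set an
   interval, so the number of missing contacts does not change. *)
Definition trimmed_hexagon (k i j : nat) :=
  hexagon k k i j && ((i < 2 * k) || (j == 0))%N.

(** * The trimmed and the stretched hexagon *)

Section Configurations.
Variable R : realType.
Local Notation plane := ('cV[R]_2).
Local Notation point := (lattice_point R).

Lemma lattice_point_inj c n : injective (@lattice_point R c n).
Proof.
move=> p q pq; apply/eqP/negPn/negP => /(lattice_far R c).
by rewrite pq /plane_sqdist !subrr expr0n addr0 ler10.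
Qed.

Definition lattice_set c n (P : nat -> nat -> bool) : {fset plane} :=
  [fset lattice_point R c p | p in [set p : 'I_n * 'I_n | P p.1 p.2]%SET]%fset.

Lemma lattice_set_sum c n (P : nat -> nat -> bool) (F : plane -> R) :
  \sum_(x <- lattice_set c n P) F x =
  \sum_(p : 'I_n * 'I_n | P p.1 p.2) F (lattice_point R c p).
Proof.
rewrite /lattice_set big_imfset /=; last by move=> p q _ _; exact: lattice_point_inj.
by rewrite big_enum; apply: eq_bigl => p; rewrite inE.
Qed.

Lemma point_0 c n (p : 'I_n * 'I_n) :
  lattice_point R c p 0 0 = Num.sqrt 3 / 2 * (p.1%:R + p.2%:R - 2 * c%:R).
Proof. by rewrite mxE. Qed.

Lemma point_1 c n (p : 'I_n * 'I_n) :
  lattice_point R c p 1 0 = (p.1%:R - p.2%:R) / 2.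
Proof. by rewrite mxE. Qed.

Lemma sqrt3_sqr (t : R) : (Num.sqrt 3 / 2 * t) ^+ 2 = 3 / 4 * t ^+ 2.
Proof. by rewrite !exprMn sqr_sqrtr// exprVn; field. Qed.

(** Swapping the two indices kills the mixed term, and isotropy merges the two squares into
    [w 0 0 ^+ 2 + w 1 0 ^+ 2 = 1]. *)
Lemma hexagon_moment k (w : plane) : w 0 0 ^+ 2 + w 1 0 ^+ 2 = 1 ->
  \sum_(p : 'I_(2 * k).+1 * 'I_(2 * k).+1 | hexagon k k p.1 p.2)
    dot w (lattice_point R k p) ^+ 2 =
  3 / 4 * \sum_(p : 'I_(2 * k).+1 * 'I_(2 * k).+1 | hexagon k k p.1 p.2)
    (p.1%:R + p.2%:R - 2 * k%:R) ^+ 2.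
Proof.
move=> w1; pose s (p : 'I_(2 * k).+1 * 'I_(2 * k).+1) : R := p.1%:R + p.2%:R - 2 * k%:R.
pose d (p : 'I_(2 * k).+1 * 'I_(2 * k).+1) : R := p.1%:R - p.2%:R.
have cross : \sum_(p : 'I_(2 * k).+1 * 'I_(2 * k).+1 | hexagon k k p.1 p.2) s p * d p = 0.
  have sw : injective (fun p : 'I_(2 * k).+1 * 'I_(2 * k).+1 => (p.2, p.1)).
    by move=> [a b] [a' b'] [-> ->].
  set X := LHS; suff : X = - X by move=> h; lra.
  rewrite {1}/X (reindex_inj sw) /X -sumrN; apply: eq_big => p /=.
    by rewrite /hexagon andbCA addnC.
  by move=> _; rewrite /s /d /=; ring.
have E p : dot w (lattice_point R k p) ^+ 2 = 3 / 4 * w 0 0 ^+ 2 * s p ^+ 2 +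
    (Num.sqrt 3 / 2 * w 0 0 * w 1 0) * (s p * d p) + w 1 0 ^+ 2 / 4 * d p ^+ 2.
  rewrite /dot point_0 point_1 -/(s p) -/(d p).
  have : (Num.sqrt 3 : R) ^+ 2 = 3 by rewrite sqr_sqrtr.
  by move: (Num.sqrt 3 : R) => t t3; rewrite -t3; field.
under eq_bigr do rewrite E.
rewrite !big_split /= -!mulr_sumr cross mulr0 addr0.
have : \sum_(p : 'I_(2 * k).+1 * 'I_(2 * k).+1 | hexagon k k p.1 p.2) d p ^+ 2 =
  3 * \sum_(p : 'I_(2 * k).+1 * 'I_(2 * k).+1 | hexagon k k p.1 p.2) s p ^+ 2.
  exact: hexagon_isotropic.
move=> ->; set S := \sum_(p | _) s p ^+ 2.
transitivity (3 / 4 * S * (w 0 0 ^+ 2 + w 1 0 ^+ 2)); last by rewrite w1 mulr1.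
by field.
Qed.

Lemma hexagon_cardE B q : (q <= 2 * B)%N ->
  (#|[set p : 'I_(2 * B).+1 * 'I_(2 * B).+1 | hexagon B q p.1 p.2]%SET| + q * (q + 1) =
   (2 * B + 1) ^ 2)%N.
Proof.
move=> qB; apply/eqP; rewrite -(eqr_nat R) (natrD _ #|_|) (hexagon_card R qB).
rewrite (natrM _ q) (natrX _ (2 * B + 1)) (natrD _ q) (natrD _ (2 * B)) (natrM _ 2).
by rewrite subrK.
Qed.

Lemma trimmed_card k :
  #|[set p : 'I_(2 * k).+1 * 'I_(2 * k).+1 | trimmed_hexagon k p.1 p.2]%SET| =
  (3 * k ^ 2 + 2 * k + 1)%N.
Proof.
have := @hexagon_cardE k k ltac:(lia).
set H := [set p | _]%SET; set A := [set p | _]%SET => cH.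
have AH : A \subset H by apply/fintype.subsetP => p; rewrite !inE => /andP[].
(* The deleted points have first index [2 k] and second index from 1 to [k]. *)
pose f (j : 'I_k) : 'I_(2 * k).+1 * 'I_(2 * k).+1 := (ord_max, inord j.+1).
have fE (j : 'I_k) : (inord j.+1 : 'I_(2 * k).+1) = j.+1 :> nat.
  by rewrite inordK//; have := ltn_ord j; lia.
have finj : injective f.
  by move=> i j [/(congr1 val)]; rewrite /= -!/(nat_of_ord _) !fE => -[/val_inj].
have : #|H :\: A| = k.
  rewrite -[RHS]card_ord -(card_imset _ finj); apply: eq_card => -[i j].
  apply/idP/imsetP => [|[l _ [-> ->]]].
    rewrite !inE /trimmed_hexagon /hexagon /= => h.
    have jk : (j.-1 < k)%N by move: h; lia.
    exists (Ordinal jk) => //; congr (_, _); apply: val_inj; rewrite /= ?fE /=.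
      by move: h; have := ltn_ord i; lia.
    by rewrite inordK; move: h; have := ltn_ord j; lia.
  rewrite !inE /trimmed_hexagon /hexagon /= !fE; have := ltn_ord l; lia.
rewrite cardsDS// => /eqP; have := subset_leq_card AH; move: cH.
set a := #|A|; set h := #|H|; lia.
Qed.

Lemma trimmed_ground_state k :
  ground_state (3 * k ^ 2 + 2 * k + 1) (lattice_set k (2 * k).+1 (trimmed_hexagon k)).
Proof.
rewrite -(trimmed_card k); apply: (@lattice_ground_state R k (2 * k).+1 (2 * k) k k) => //.
- by move=> i j; rewrite /trimmed_hexagon /hexagon => ?; split; lia.
- by move=> i i' j; rewrite /trimmed_hexagon /hexagon; lia.
- by move=> i j j'; rewrite /trimmed_hexagon /hexagon; lia.
- by move=> i j i' j'; rewrite /trimmed_hexagon /hexagon; lia.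
- lia.
- exact: trimmed_card.
Qed.

(** The stretched hexagon has [3 k^2 + 3 k + 1 - 12 m^2] points; this is the source of the choice
    [k = 12 m^2]. *)
Lemma stretched_card m k : (0 < m)%N -> k = (12 * m ^ 2)%N ->
  #|[set p : 'I_(2 * (k - m)).+1 * 'I_(2 * (k - m)).+1 |
     hexagon (k - m) (k - 4 * m) p.1 p.2]%SET| = (3 * k ^ 2 + 2 * k + 1)%N.
Proof.
move=> m0 kE; have mk : (4 * m <= k)%N by rewrite kE; nia.
have := @hexagon_cardE (k - m) (k - 4 * m) ltac:(lia).
set h := #|_|; have [t tk] : exists t, (k = t + 4 * m)%N by exists (k - 4 * m)%N; lia.
have -> : (k - 4 * m = t)%N by lia.
have -> : (k - m = t + 3 * m)%N by lia.
move: kE; rewrite tk; nia.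
Qed.

(** Two directions lose [2 m] lines each and the third gains [4 m], so the total number of lines,
    and with it the contact deficit, is unchanged. *)
Lemma stretched_ground_state m k : (0 < m)%N -> k = (12 * m ^ 2)%N ->
  ground_state (3 * k ^ 2 + 2 * k + 1)
    (lattice_set (k - m) (2 * (k - m)).+1 (hexagon (k - m) (k - 4 * m))).
Proof.
move=> m0 kE; have mk : (4 * m <= k)%N by rewrite kE; nia.
rewrite -(stretched_card m0 kE).
apply: (@lattice_ground_state R (k - m) (2 * (k - m)).+1 (2 * k + 4 * m) k (k - 4 * m)) => //.
- by move=> i j; rewrite /hexagon => ?; split; lia.
- by move=> i i' j; rewrite /hexagon; lia.
- by move=> i j j'; rewrite /hexagon; lia.
- by move=> i j i' j'; rewrite /hexagon; lia.
- lia.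
- exact: stretched_card.
Qed.


Lemma stretched_symmetric B q (g : R -> R) :
  \sum_(x <- lattice_set B (2 * B).+1 (hexagon B q)) g (x 0 0) =
  \sum_(x <- lattice_set B (2 * B).+1 (hexagon B q)) g (- x 0 0).
Proof.
rewrite !lattice_set_sum.
pose rv (p : 'I_(2 * B).+1 * 'I_(2 * B).+1) := (rev_ord p.1, rev_ord p.2).
have rvinj : injective rv.
  by move=> [a b] [c d] /pair_equal_spec[/rev_ord_inj /= -> /rev_ord_inj /= ->].
rewrite (reindex_inj rvinj); apply: eq_big => p /=.
  rewrite /hexagon /=; have := ltn_ord p.1; have := ltn_ord p.2.
  by move: (nat_of_ord p.1) (nat_of_ord p.2) => i j; lia.
move=> _; congr g; rewrite !point_0 /= -[RHS]mulrN (subSS p.1) (subSS p.2); congr (_ * _).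
have p1 : (p.1 <= 2 * B)%N by rewrite -ltnS.
have p2 : (p.2 <= 2 * B)%N by rewrite -ltnS.
by rewrite !natrB// natrM; ring.
Qed.

Lemma flat_norm_hexagons m k N (Q : orthogonal2 R) (a : plane) :
  (0 < m)%N -> k = (12 * m ^ 2)%N -> N = (3 * k ^ 2 + 2 * k + 1)%N ->
  ((3 / 8 * m%:R * k%:R ^+ 3 / N%:R ^+ 2)%:E <=
   flat_norm (cadd
     (empirical_measure N (lattice_set k (2 * k).+1 (trimmed_hexagon k)))
     (copp (moved_measure (empirical_measure N
       (lattice_set (k - m) (2 * (k - m)).+1 (hexagon (k - m) (k - 4 * m)))) Q a))))%E.
Proof.
move=> m0 kE NE; have mk : (4 * m <= k)%N by rewrite kE; nia.
pose I : R := 3 / 4 * \sum_(p : 'I_(2 * k).+1 * 'I_(2 * k).+1 | hexagon k k p.1 p.2)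
    (p.1%:R + p.2%:R - 2 * k%:R) ^+ 2.
have -> : 3 / 8 * m%:R * k%:R ^+ 3 / N%:R ^+ 2 =
    (3 / 4 * (m%:R * k%:R ^+ 3)) / (2 * N%:R ^+ 2) :> R.
  by field; rewrite pnatr_eq0 NE addn1.
apply: (@flat_norm_moment_gap _ _ _ _ I).
- by rewrite NE addn1.
- by rewrite NE; have [] := trimmed_ground_state k.
- by rewrite NE; have [] := stretched_ground_state m0 kE.
- exact: stretched_symmetric.
- move=> x /imfsetP[p /=]; rewrite inE => /and4P[_ _ hp1 hp2] ->.
  rewrite point_0 sqrt3_sqr.
  have h1 : (p.1 + p.2 <= 2 * (k - m) + (k + 2 * m))%N.
    by move: hp2 mk; move: (p.1 + p.2)%N => u; lia.
  have h2 : (2 * (k - m) <= p.1 + p.2 + (k + 2 * m))%N.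
    by move: hp1 mk; move: (p.1 + p.2)%N => u; lia.
  move: h1 h2; rewrite -!(ler_nat R) (natrD _ (p.1 + p.2)) (natrD _ p.1).
  rewrite (natrD _ (2 * (k - m))) (natrM _ 2 (k - m)).
  move: (p.1%:R + p.2%:R) (2 * (k - m)%:R) => u v h1 h2.
  have t2 : (u - v) ^+ 2 <= (k + 2 * m)%:R ^+ 2 :> R.
    rewrite -[leLHS]real_normK ?num_real// ler_sqr ?nnegrE// ler_norml.
    by apply/andP; split; lra.
  (* First coordinates are at most [sqrt 3 / 2 (k + 2 m)] in absolute value, which after rescaling
     lies in the range of the midpoint inequality. *)
  have : 3 * (k + 2 * m)%:R ^+ 2 <= 2 * N%:R :> R.
    by rewrite -natrX -!natrM ler_nat NE kE; nia.
  lra.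
(* Trimming only removes nonnegative terms from the moment of the full hexagon. *)
- move=> w w1; rewrite /I -(hexagon_moment k w1) lattice_set_sum.
  rewrite [leRHS](bigID (fun p : 'I_(2 * k).+1 * 'I_(2 * k).+1 =>
    (p.1 < 2 * k) || (p.2 == 0%N :> nat))%N) /=.
  by rewrite lerDl sumr_ge0// => p _; exact: sqr_ge0.
- rewrite lattice_set_sum; under [leRHS]eq_bigr do rewrite point_0 sqrt3_sqr.
  rewrite -mulr_sumr -mulrDr ler_pM2l//; exact: hexagon_gain.
Qed.

End Configurations.

(** * The lower bound of order [N^(-1/4)] *)

Unset Implicit Arguments.

Theorem theorem2p6 (R : realType) :
  exists c : R, 0 < c /\
    forall M : nat, exists N : nat, (M <= N)%N /\
      exists S' St : {fset 'cV[R]_2},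
        ground_state N S' /\ ground_state N St /\
        ((c * N%:R `^ (- 4^-1))%:E <=
          ereal_inf [set z : \bar R |
            exists (Q : orthogonal2 R) (a : 'cV[R]_2),
              z = flat_norm
                    (cadd (empirical_measure N S')
                      (copp (moved_measure (empirical_measure N St) Q a)))])%E.
Proof.
(* From [N <= 6 k^2] the bound [3 / 8 m k^3 / N^2] is at least [m / (96 k) = 1 / (12 * 96 m)], and
   [m^4 <= N] turns [1 / m] into [N^(-1/4)]. *)
have c0 : 0 < (12 * 96)^-1 :> R by rewrite invr_gt0 mulr_gt0 ?ltr0n.
exists (12 * 96)^-1; split=> //.
move=> M; have [m [m0 Mm]] : exists m, (0 < m)%N /\ (M <= m)%N.
  by exists M.+1; rewrite leqnSn.
have [k kE] : exists k, k = (12 * m ^ 2)%N by eexists.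
have [N NE] : exists N, N = (3 * k ^ 2 + 2 * k + 1)%N by eexists.
exists N; split; first by rewrite NE kE; nia.
exists (lattice_set R k (2 * k).+1 (trimmed_hexagon k)).
exists (lattice_set R (k - m) (2 * (k - m)).+1 (hexagon (k - m) (k - 4 * m))).
split; first by rewrite NE; exact: trimmed_ground_state.
split; first by rewrite NE; exact: stretched_ground_state.
apply: le_ereal_inf_tmp => _ [Q [a ->]].
apply: le_trans (flat_norm_hexagons Q a m0 kE NE); rewrite lee_fin.
have m1 : 1 <= m%:R :> R by rewrite ler1n.
have Nm : m%:R ^+ 4 <= N%:R :> R by rewrite -natrX ler_nat NE kE; nia.
have Nk : N%:R <= 6 * k%:R ^+ 2 :> R.
  rewrite -natrX -natrM ler_nat NE; have : (0 < k)%N by rewrite kE; nia.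
  nia.
have k0 : k%:R = 12 * m%:R ^+ 2 :> R by rewrite kE natrM natrX.
have N0 : 0 < N%:R :> R by apply: lt_le_trans Nm; rewrite exprn_gt0//; lra.
have root : N%:R `^ (- 4^-1) <= m%:R^-1 :> R.
  rewrite powRN lef_pV2 ?posrE ?powR_gt0//; last by lra.
  have -> : m%:R = (m%:R ^+ 4) `^ 4^-1 :> R.
    by rewrite -powR_mulrn ?ler0n// -powRrM mulfV ?pnatr_eq0// powRr1.
  by rewrite ge0_ler_powR ?nnegrE ?exprn_ge0// ?ltW// invr_ge0.
apply: (@le_trans _ _ ((12 * 96)^-1 * m%:R^-1)); first by rewrite ler_pM2l.
rewrite ler_pdivlMr ?exprn_gt0//.
have N2 : N%:R ^+ 2 <= (6 * k%:R ^+ 2) ^+ 2 :> R.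
  have N1 := ltW N0; have N6 := le_trans N1 Nk.
  by rewrite ler_sqr ?nnegrE.
apply: (@le_trans _ _ ((12 * 96)^-1 * m%:R^-1 * (6 * k%:R ^+ 2) ^+ 2)).
  by rewrite ler_pM2l// mulr_gt0// invr_gt0; lra.
rewrite k0 le_eqVlt; apply/orP; left; apply/eqP; field.
by rewrite gt_eqF//; lra.
Qed.
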